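(* Let $T>0$, let $m_0$ be a probability density on $\mathbb{R}$, let $H,V,u_T:\mathbb{R}\to\mathbb{R}$ and $Q:[0,T]\to\mathbb{R}$, and let $F(v)=\sup_{p\in\mathbb{R}}[pv-H(p)]$. Suppose that: there are $c>0$, $p>1$ with $F(v)\ge c|v|^p$ for all $v$; there are $\kappa>0$, $C>0$ with $H''\ge\kappa$ and $|H'''|\le C$ on $\mathbb{R}$; $Q\in C^\infty([0,T])$; $V,u_T,m_0\in C^2(\mathbb{R})$, $V,u_T$ are globally Lipschitz, and $|V''|,|u_T''|,|m_0''|$ are bounded; and $V,u_T$ are convex. Let $(\varphi,\varpi)\in C^2([0,T]\times\mathbb{R})\times C^1([0,T])$ be a critical point of the functional $$\tilde I[\varphi,\varpi]=\int_0^T\int_{\mathbb{R}}L(\varphi_t,\varphi_x)-\varpi(\varphi_t+Q\varphi_x)-V\varphi_x-u_T'(x)\varphi_t\,dx\,dt$$ among pairs in $C^2([0,T]\times\mathbb{R})\times C^1([0,T])$ satisfying $\varphi(0,x)=\int_{-\infty}^xm_0(y)\,dy$. Assume further that $\varphi_x>0$. Then the corresponding Euler–Lagrange equation (together with the natural boundary condition at $t=T$) is equivalent to the system $$-\left(F'\left(\frac{\varphi_t}{\varphi_x}\right)-\varpi\right)_t+\left(H\left(F'\left(\frac{\varphi_t}{\varphi_x}\right)\right)\right)_x+V'=0\quad\text{on }[0,T]\times\mathbb{R},$$ $$-\int_{\mathbb{R}}(\varphi_t+Q\varphi_x)\,dx=0\quad\text{for }t\in[0,T],$$ with the terminal condition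 $$F'\left(\frac{\varphi_t(T,x)}{\varphi_x(T,x)}\right)-\varpi(T)=u_T'(x),\qquad x\in\mathbb{R}.$$
   Context: $L(z,y)=F(z/y)\,y$ for $(z,y)\in\mathbb{R}\times(0,\infty)$; $L(z,0)=+\infty$ for $z\ne0$; $L(0,0)=0$. Subscripts $t,x$ denote partial derivatives; $L_z,L_y$ are the partial derivatives of $L$. $(\varphi,\varpi)$ is a critical point if $\frac{d}{d\varepsilon}\tilde I[(\varphi,\varpi)+\varepsilon(\beta^1,\beta^2)]\big|_{\varepsilon=0}=0$ for all $(\beta^1,\beta^2)\in C^1_c((0,T]\times\mathbb{R})\times C([0,T])$. The corresponding Euler–Lagrange equation is the set of conditions this imposes on $(\varphi,\varpi)$: the stationarity condition in $\varphi$, $-(L_z(\varphi_t,\varphi_x)-\varpi)_t-(L_y(\varphi_t,\varphi_x))_x+V'=0$ on $[0,T]\times\mathbb{R}$, with natural boundary condition $L_z(\varphi_t(T,x),\varphi_x(T,x))-\varpi(T)-u_T'(x)=0$, and the stationarity condition in $\varpi$. *)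

(* Defs.v *)
From HB Require Import structures.
From mathcomp Require Import all_boot all_order all_algebra.
From mathcomp Require Import all_classical all_reals all_analysis.

Set Implicit Arguments.
Unset Strict Implicit.
Unset Printing Implicit Defensive.

Import Order.TTheory GRing.Theory Num.Theory.
Import numFieldNormedType.Exports.

Local Open Scope ring_scope.
Local Open Scope classical_set_scope.

(** Functions on [[0, T]] or [[0, T] * R] are total functions of which only the
    values at times [t] in [[0, T]] matter; accordingly, time derivatives are
    limits of difference quotients along increments that stay in [[0, T]], hence
    one-sided at [t = 0] and [t = T]. *)
Section Regularity.
Context {R : realType}.
Implicit Types (T t x : R) (g : R -> R) (f : R -> R -> R).

Definition time_quotient T g t : R -> R := fun s => (g s - g t) / (s - t).

Definition time_derivable T g t : Prop :=
  cvg (time_quotient T g t s @[s --> within `[0, T] t^']).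

Definition time_derive T g t : R :=
  lim (time_quotient T g t s @[s --> within `[0, T] t^']).

Definition C0_time T g : Prop := {within `[0, T], continuous g}.

Definition C1_time T g : Prop :=
  (forall t : R, 0 <= t <= T -> time_derivable T g t) /\
  C0_time T (time_derive T g).

Definition Cinfty_time T g : Prop :=
  forall (n : nat) t, 0 <= t <= T ->
    time_derivable T (iter n (time_derive T) g) t.

Definition C2_line g : Prop :=
  [/\ forall x, derivable g x 1,
      forall x, derivable (derive1 g) x 1 &
      continuous (derive1n 2 g)].

(** [pt T f] and [px f] are the partial derivatives $f_t$ and $f_x$. *)
Definition pt T f : R -> R -> R := fun t x => time_derive T (fun s => f s x) t.
Definition px f : R -> R -> R := fun t x => derive1 (f t) x.

Definition strip T : set (R * R) := `[0, T] `*` setT.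

Definition C0_strip T f : Prop :=
  {within strip T, continuous (fun z : R * R => f z.1 z.2)}.

Definition C1_strip T f : Prop :=
  [/\ C0_strip T f,
      forall t x : R, 0 <= t <= T ->
        time_derivable T (fun s => f s x) t /\ derivable (f t) x 1,
      C0_strip T (pt T f) &
      C0_strip T (px f)].

Definition C2_strip T f : Prop :=
  [/\ C1_strip T f, C1_strip T (pt T f) & C1_strip T (px f)].

(** The space $C^1_c((0,T]\times\mathbb{R})$, its elements being extended by 0 to
    [t = 0]. *)
Definition strip_support T f : set (R * R) :=
  closure [set z | strip T z /\ f z.1 z.2 != 0].

Definition C1c_strip T f : Prop :=
  [/\ C1_strip T f,
      compact (strip_support T f) &
      strip_support T f `<=` `]0, T] `*` setT].

End Regularity.

Section Functional.
Context {R : realType}.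
Local Notation mu := (@lebesgue_measure R).

Definition probability_density (m : R -> R) : Prop :=
  (forall x, 0 <= m x) /\ (\int[mu]_x (m x)%:E = 1)%E.

(** The real [sup] is a genuine supremum under the standing assumption
    [H'' >= kappa > 0], which bounds [p * v - H p] from above in [p]. *)
Definition legendre (H : R -> R) (v : R) : R :=
  sup [set p * v - H p | p in [set: R]].

(** The value at [y < 0], where the Lagrangian is not specified, is set to
    [+oo]; it plays no role around a [phi] with [phi_x > 0]. *)
Definition lagrangian (F : R -> R) (z y : R) : \bar R :=
  if 0 < y then (F (z / y) * y)%:E
  else if (y == 0) && (z == 0) then 0%E else +oo%E.

Definition lagrangian_z (F : R -> R) (z y : R) : R :=
  derive1 (fun s => fine (lagrangian F s y)) z.

Definition lagrangian_y (F : R -> R) (z y : R) : R :=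
  derive1 (fun s => fine (lagrangian F z s)) y.

(** An extended real: it is finite only if the inner integral converges
    absolutely for almost every [t] and the outer one converges absolutely. *)
Definition functional (T : R) (F Q V uT : R -> R)
    (phi : R -> R -> R) (w : R -> R) : \bar R :=
  (\int[mu]_(t in `[0%R, T]) \int[mu]_x
     (lagrangian F (pt T phi t x) (px phi t x)
      - (w t * (pt T phi t x + Q t * px phi t x))%:E
      - (V x * px phi t x)%:E
      - (derive1 uT x * pt T phi t x)%:E))%E.

(** [d/de functional ((phi, w) + e (b1, b2)) = 0] at [e = 0], which includes
    that the functional is finite for [e] near 0 and differentiable at 0. *)
Definition stationary_along (T : R) (F Q V uT : R -> R)
    (phi : R -> R -> R) (w : R -> R) (b1 : R -> R -> R) (b2 : R -> R) : Prop :=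
  let J (e : R) := functional T F Q V uT
    (fun t x => phi t x + e * b1 t x) (fun t => w t + e * b2 t) in
  (\forall e \near (0 : R), J e \is a fin_num) /\
  is_derive (0 : R) 1 (fun e => fine (J e)) 0.

Definition critical_point (T : R) (F Q V uT : R -> R)
    (phi : R -> R -> R) (w : R -> R) : Prop :=
  forall (b1 : R -> R -> R) (b2 : R -> R),
    C1c_strip T b1 -> C0_time T b2 ->
    stationary_along T F Q V uT phi w b1 b2.

Definition admissible (T : R) (m0 : R -> R)
    (phi : R -> R -> R) (w : R -> R) : Prop :=
  [/\ C2_strip T phi, C1_time T w &
      forall x, phi 0 x = \int[mu]_(y in `]-oo, x]) m0 y].

(** The Euler-Lagrange equation: stationarity in [phi], its natural boundary
    condition at [t = T], and stationarity in [w]. *)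
Definition euler_lagrange (T : R) (F Q V uT : R -> R)
    (phi : R -> R -> R) (w : R -> R) : Prop :=
  [/\ forall t x : R, 0 <= t <= T ->
        - time_derive T
            (fun s => lagrangian_z F (pt T phi s x) (px phi s x) - w s) t
        - derive1 (fun y => lagrangian_y F (pt T phi t y) (px phi t y)) x
        + derive1 V x = 0,
      forall x,
        lagrangian_z F (pt T phi T x) (px phi T x) - w T - derive1 uT x = 0 &
      forall b2 : R -> R, C0_time T b2 ->
        stationary_along T F Q V uT phi w (fun _ _ => 0) b2].

(** The last integral is taken in the extended reals, so that its vanishing
    includes the absolute convergence of the integral. *)
Definition price_system (T : R) (H F Q V uT : R -> R)
    (phi : R -> R -> R) (w : R -> R) : Prop :=
  [/\ forall t x : R, 0 <= t <= T ->
        - time_derive T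
            (fun s => derive1 F (pt T phi s x / px phi s x) - w s) t
        + derive1 (fun y => H (derive1 F (pt T phi t y / px phi t y))) x
        + derive1 V x = 0,
      forall t : R, 0 <= t <= T ->
        (- (\int[mu]_x (pt T phi t x + Q t * px phi t x)%:E) = 0)%E &
      forall x, derive1 F (pt T phi T x / px phi T x) - w T = derive1 uT x].

End Functional.

(* Main.v *)
Require Import Defs.
From HB Require Import structures.
From mathcomp Require Import all_boot all_order all_algebra.
From mathcomp Require Import all_classical all_reals all_analysis.
From mathcomp Require Import measurable_realfun lebesgue_integral_under.
From mathcomp Require Import ring lra.

Import Order.TTheory GRing.Theory Num.Theory.
Import numFieldNormedType.Exports.

Local Open Scope ring_scope.
Local Open Scope classical_set_scope.

(** Where [phi_x > 0], the Lagrangian [L(z, y) = F(z / y) y] is differentiable, with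
    [L_z = F'(z / y)], and [L_y = F(z / y) - (z / y) F'(z / y)] is [- H(F'(z / y))]
    by the equality case of Fenchel-Young. The differential equation and the
    condition at [t = T] therefore coincide term by term in the two systems
    ([lagrangian_z_momentum], [derive1_lagrangian_y]). What remains is to compare
    stationarity in [w] with the balance condition
    [\int (phi_t + Q phi_x) dx = 0] for every [t]. One implication holds because
    a critical point is in particular stationary when [w] alone varies.

    For the other one, the functional is affine in [w], and formally its
    derivative in the direction [b] is minus the time integral of [b] against the
    total flux [\int (phi_t + Q phi_x) dx]; the direction [b] equal to the total
    flux gives the claim ([linear_variation_eq0]). This needs the total flux to be
    finite and continuous in time, although nothing is assumed on the decay of
    [phi_t] and [phi_x] at infinity. Both follow from the differential equation:
    the momentum [q = F'(phi_t / phi_x)] solves the transport equation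
    [q_t - H'(q) q_x = w' + V'] with [q = u_T' + w] at [t = T]. As [V'], [w'] and
    [u_T'] are bounded, integration along the characteristics bounds [q]
    ([transport_bound], [momentum_bounded]), hence also the velocity
    [phi_t / phi_x = H'(q)], say by [M]. Then [phi] is monotone along the lines
    of slope [M] and [- M], so that
    [phi(0, x - M t) <= phi(t, x) <= phi(0, x + M t)] ([finite_speed]): each
    [phi(t, .)] is trapped between translates of the distribution function of
    [m0]. So [phi_x(t, .)] is integrable with tails that are small uniformly in
    [t], and so is the flux, which it dominates; continuity of the total flux
    follows ([C0_total_flux]). *)

(** * One-variable calculus *)

Section Calculus.
Set Implicit Arguments.
Unset Strict Implicit.
Context {R : realType}.
Implicit Types f : R -> R.

Lemma derivable_is_derive1 (f : R -> R) x :
  derivable f x 1 -> is_derive x 1 f ((derive1 f) x).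
Proof. by move=> df; apply: DeriveDef; rewrite ?derive1E. Qed.

Lemma is_derive1_val (f : R -> R) (x l : R) : is_derive x 1 f l -> derive1 f x = l.
Proof. by move=> df; rewrite derive1E; case: df. Qed.

Lemma derivable_continuousT (f : R -> R) :
  (forall x, derivable f x 1) -> continuous f.
Proof. by move=> df x; apply/differentiable_continuous/derivable1_diffP. Qed.

Lemma MVT_line (f : R -> R) (a b : R) : (forall x, derivable f x 1) -> a <= b ->
  exists2 c, a <= c <= b & f b - f a = derive1 f c * (b - a).
Proof.
move=> df ab.
have [c ci e] : exists2 c, c \in `[a, b]%R & f b - f a = derive1 f c * (b - a).
  apply: MVT_segment; first exact: ab.
    by move=> x _; exact: derivable_is_derive1.
  by apply: continuous_subspaceT; apply: derivable_continuousT.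
by exists c => //; move: ci; rewrite in_itv.
Qed.

Lemma is_derive_quotient (a b : R -> R) (x a' b' : R) :
  is_derive x 1 a a' -> is_derive x 1 b b' -> b x != 0 ->
  is_derive x 1 (fun y => a y / b y) ((a' * b x - a x * b') / b x ^+ 2).
Proof.
move=> da db b0; have dV := is_deriveV b0 db.
apply: (is_derive_eq (is_deriveM da dV)).
by rewrite /GRing.scale /=; field.
Qed.

Lemma lipschitz_derive1_le (f : R -> R) (k x : R) :
  k.-lipschitz f -> derivable f x 1 -> `|derive1 f x| <= k.
Proof.
move=> lf /derivable_is_derive1/is_derive1_caratheodory[h [fE ch <-]].
rewrite leNgt; apply/negP => kh.
have /cvgr_gt/(_ _ kh) : `|h z| @[z --> x] --> `|h x| by apply: cvg_norm; exact: ch.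
move=> /nbhs_ballP[d /= d0 /(_ (x + d / 2))]; rewrite /ball /=.
have d20 : 0 < d / 2 by rewrite divr_gt0.
rewrite opprD addrA subrr sub0r normrN gtr0_norm//.
have dd : d / 2 < d by lra.
move=> /(_ dd); apply/negP; rewrite -leNgt.
have := lf (x + d / 2, x); rewrite /= => /(_ (conj I I)).
rewrite fE normrM addrAC subrr add0r.
by rewrite ler_pM2r// normr_gt0 gt_eqF.
Qed.

End Calculus.

(** * Convex duality and the Lagrangian *)

Section Legendre.
Set Implicit Arguments.
Unset Strict Implicit.
Context {R : realType} (H : R -> R) (kappa : R).
Hypothesis kappa0 : 0 < kappa.
Hypothesis Hd : forall x, derivable H x 1.
Hypothesis H'd : forall x, derivable (derive1 H) x 1.
Hypothesis H''d : forall x, derivable (derive1 (derive1 H)) x 1.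
Hypothesis H''ge : forall x, kappa <= derive1 (derive1 H) x.

Local Notation h := (derive1 H).
Local Notation F := (legendre H).

Lemma slope_H' a b : a <= b -> kappa * (b - a) <= h b - h a.
Proof.
move=> ab; have [c _ ->] := MVT_line H'd ab.
by rewrite ler_wpM2r// subr_ge0.
Qed.

(** Strong convexity makes [H'] grow at least linearly, whence the intermediate
    value theorem reaches every slope. *)
Lemma H'_surj v : exists p, h p = v.
Proof.
(* On [[- r, r]], [h] varies by at least [`|v - h 0|] on each side of [0]. *)
pose r := `|v - h 0| / kappa.
have r0 : 0 <= r by rewrite divr_ge0// ltW.
have kr : kappa * r = `|v - h 0| by rewrite /r mulrC divfK// gt_eqF.
have [p _ <-] : exists2 c, c \in `[- r, r]%R & h c = v.
  apply: IVT; first lra.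
    exact: continuous_subspaceT (derivable_continuousT H'd).
  rewrite ge_min le_max.
  have := @slope_H' (- r) 0 ltac:(lra); have := @slope_H' 0 r ltac:(lra).
  rewrite subr0 opprK add0r kr => h1 h2.
  have := ler_norm (v - h 0); have := ler_norm (- (v - h 0)); rewrite normrN.
  by move=> *; apply/andP; split; apply/orP; [left|right]; lra.
by exists p.
Qed.

(** Convexity: [H'] is increasing, so the graph of [H] lies above its tangents. *)
Lemma H_tangent p q : H p + h p * (q - p) <= H q.
Proof.
have [pq|/ltW qp] := leP p q.
  have [c /andP[pc cq] e] := MVT_line Hd pq.
  have : h p <= h c.
    by rewrite -subr_ge0; apply: le_trans (slope_H' pc); rewrite mulr_ge0 ?subr_ge0// ltW.
  move=> hc; have : h p * (q - p) <= h c * (q - p) by rewrite ler_wpM2r ?subr_ge0.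
  by rewrite -e; lra.
have [c /andP[pc cq] e] := MVT_line Hd qp.
have : h c <= h p.
  by rewrite -subr_ge0; apply: le_trans (slope_H' cq); rewrite mulr_ge0 ?subr_ge0// ltW.
move=> hc; have : h c * (p - q) <= h p * (p - q) by rewrite ler_wpM2r ?subr_ge0.
by rewrite -e; lra.
Qed.

(** The tangent inequality says that the supremum defining [F v] is attained at
    the point [p] with [H' p = v]. *)
Lemma legendreE p : F (h p) = p * h p - H p.
Proof.
rewrite /legendre; set S := (X in sup X).
have Sp : S (p * h p - H p) by exists p.
have ubS : ubound S (p * h p - H p).
  by move=> _ [q _ <-]; have := H_tangent p q; nra.
apply/eqP; rewrite eq_le ge_sup//=; last by exists (p * h p - H p).
by apply: ub_le_sup => //; exists (p * h p - H p).
Qed.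

(** The two tangent inequalities at [p] and [q] squeeze the difference quotient of
    [F] between [p] and [q], and [`|q - p| <= `|h q - h p| / kappa]. *)
Lemma is_derive_legendre p : is_derive (h p) 1 F p.
Proof.
apply/is_derive1_caratheodory.
exists (fun z => if z == h p then p else (F z - F (h p)) / (z - h p)).
split; last by rewrite eqxx.
  move=> z; case: eqP => [->|/eqP]; first by rewrite !subrr mulr0.
  by rewrite -subr_eq0 => /divfK->.
rewrite /prop_for /continuous_at /= eqxx.
apply/cvgrPdist_le => e e0; near=> z.
case: eqP => [_|/eqP zp]; first by rewrite subrr normr0 ltW.
have zlt : `|z - h p| <= e * kappa.
  near: z; apply/nbhs_normP; exists (e * kappa) => /=; first by rewrite mulr_gt0.
  by move=> z /= /ltW; rewrite distrC.
have [q qz] := H'_surj z; rewrite -{}qz in zp zlt *.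
have qp : `|q - p| * kappa <= `|h q - h p|.
  have [pq|/ltW pq] := leP p q.
    rewrite ger0_norm ?subr_ge0// mulrC; exact: le_trans (slope_H' pq) (ler_norm _).
  rewrite ler0_norm ?subr_le0// opprB mulrC distrC.
  exact: le_trans (slope_H' pq) (ler_norm _).
have d0 : h q - h p != 0 by rewrite subr_eq0.
have -> : p - (F (h q) - F (h p)) / (h q - h p)
        = (p * (h q - h p) - (F (h q) - F (h p))) / (h q - h p).
  by rewrite [RHS]mulrBl mulfK.
rewrite normrM normfV ler_pdivrMr ?normr_gt0// !legendreE.
have t1 := H_tangent p q; have t2 := H_tangent q p.
have -> : `|p * (h q - h p) - (q * h q - H q - (p * h p - H p))| =
          - (p * (h q - h p) - (q * h q - H q - (p * h p - H p))).
  by rewrite ler0_norm//; lra.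
apply: (@le_trans _ _ ((q - p) * (h q - h p))); first lra.
apply: le_trans (ler_norm _) _; rewrite normrM ler_wpM2r//.
by rewrite -(@ler_pM2r _ kappa)//; apply: le_trans qp _.
Unshelve. all: by end_near. Qed.

Lemma legendre'_H'K p : derive1 F (h p) = p.
Proof. by rewrite derive1E; case: (is_derive_legendre p). Qed.

Lemma H'_legendre'K v : h (derive1 F v) = v.
Proof. by have [p <-] := H'_surj v; rewrite legendre'_H'K. Qed.

Lemma legendre_derivable (v : R) : derivable F v 1.
Proof. by have [p <-] := H'_surj v; case: (is_derive_legendre p). Qed.

(** The equality case of Fenchel-Young; this is what turns [L_y] into [- H (F')]. *)
Lemma H_legendre' v : H (derive1 F v) = v * derive1 F v - F v.
Proof. have [p <-] := H'_surj v; rewrite legendre'_H'K legendreE; lra. Qed.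

(** [F'] is the inverse function of [H']. *)
Lemma is_derive_legendre' (v : R) :
  is_derive v 1 (derive1 F) (derive1 h (derive1 F v))^-1.
Proof.
rewrite -{1}(H'_legendre'K v); apply: is_derive_inverse.
- by near=> x; rewrite legendre'_H'K.
- by near=> x; exact: (derivable_continuousT H'd).
- by apply: derivable_is_derive1; apply: H'd.
- by rewrite gt_eqF// (lt_le_trans kappa0).
Unshelve. all: by end_near. Qed.

Lemma legendre'_derivable (v : R) : derivable (derive1 F) v 1.
Proof. by case: (is_derive_legendre' v). Qed.

Lemma legendre''_continuous : continuous (derive1 (derive1 F)).
Proof.
have -> : derive1 (derive1 F) = fun v => (derive1 h (derive1 F v))^-1.
  by apply/funext => v; rewrite derive1E; case: (is_derive_legendre' v).
move=> v; apply: cvgV; first by rewrite gt_eqF// (lt_le_trans kappa0).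
apply: continuous_comp; last exact: (derivable_continuousT H''d).
exact: (derivable_continuousT legendre'_derivable).
Qed.

End Legendre.

Section Lagrangian.
Set Implicit Arguments.
Unset Strict Implicit.
Context {R : realType}.

Lemma lagrangian_zE (F : R -> R) (z y : R) :
  (forall v, derivable F v 1) -> 0 < y -> lagrangian_z F z y = derive1 F (z / y).
Proof.
move=> dF y0; have yN0 : y != 0 by rewrite gt_eqF.
rewrite /lagrangian_z.
have -> : (fun s => fine (lagrangian F s y)) = (F \o (fun s => s / y)) * cst y.
  by apply/funext => s; rewrite /lagrangian y0.
apply: is_derive1_val.
have dq : is_derive z 1 (fun s : R => s / y) y^-1.
  apply: (is_derive_eq (is_derive_quotient (is_derive_id z 1) (is_derive_cst y z 1) yN0)).
  by rewrite /cst; field.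
have dFq := @is_derive1_comp R F (fun s => s / y) z _ _
  (derivable_is_derive1 (dF (z / y))) dq.
have := is_deriveM dFq (is_derive_cst y z 1).
move/is_derive_eq; apply.
by rewrite scaler0 add0r /GRing.scale /= mulrCA divff ?mulr1// gt_eqF.
Qed.

(** Only a neighbourhood of [y > 0] matters, where the Lagrangian is finite. *)
Lemma lagrangian_yE (F : R -> R) (z y : R) :
  (forall v, derivable F v 1) -> 0 < y ->
  lagrangian_y F z y = F (z / y) - z / y * derive1 F (z / y).
Proof.
move=> dF y0; have yN0 : y != 0 by rewrite gt_eqF.
rewrite /lagrangian_y; apply: is_derive1_val.
apply: (@near_eq_is_derive _ _ _ ((F \o (fun s => z / s)) * id)).
  near=> s; have s0 : 0 < s by near: s; exact: lt_nbhsr.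
  by rewrite /lagrangian s0.
have dq : is_derive y 1 (fun s : R => z / s) (- z / y ^+ 2).
  apply: (is_derive_eq (is_derive_quotient (is_derive_cst z y 1) (is_derive_id y 1) yN0)).
  by rewrite mul0r sub0r mulr1.
have dFq := @is_derive1_comp R F (fun s => z / s) y _ _
  (derivable_is_derive1 (dF (z / y))) dq.
have := is_deriveM dFq (is_derive_id y 1).
move/is_derive_eq; apply.
by rewrite /GRing.scale /=; field; rewrite gt_eqF.
Unshelve. all: by end_near. Qed.

End Lagrangian.

(** * Calculus on the strip *)

Section StripCalculus.
Set Implicit Arguments.
Unset Strict Implicit.

(** Continuity on a retract is global continuity after composition with the
    retraction. With [clamp] as the retraction, it turns continuity on [[0, T]] or
    on the strip into continuity on the whole line or plane. *)
Lemma within_continuous_retract (X Y : topologicalType) (A : set X)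
    (r : X -> X) (f : X -> Y) :
  continuous r -> (forall x, A (r x)) -> (forall x, A x -> r x = x) ->
  {within A, continuous f} <-> continuous (f \o r).
Proof.
move=> cr rA rK; split=> [/subspace_continuousP cf x B nB|cf].
  have := cf _ (rA x) B nB; rewrite /= !nbhs_simpl /= => nf.
  by have := cr x _ nf; rewrite /= !nbhs_simpl /=; apply: filterS => y; apply.
apply/subspace_continuousP => x Ax B; rewrite -{1}(rK _ Ax) => nB.
have := cf x B nB; rewrite /= !nbhs_simpl /=.
by apply: filterS => y /= By Ay; move: By; rewrite (rK _ Ay).
Qed.

Context {R : realType} (T : R).
Hypothesis T0 : 0 < T.
Implicit Types (t s x l : R) (g : R -> R) (f : R -> R -> R).

Definition clamp t : R := Num.max 0 (Num.min t T).

Lemma clamp_itv t : 0 <= clamp t <= T.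
Proof. by rewrite /clamp le_max lexx /= ge_max ltW//= ge_min lexx orbT. Qed.

Lemma clamp_id t : 0 <= t <= T -> clamp t = t.
Proof. by move=> /andP[t0 tT]; rewrite /clamp min_l// max_r. Qed.

Lemma clamp_continuous : continuous clamp.
Proof.
move=> t; apply: (@continuous_max _ _ (cst 0) (fun t => Num.min t T)).
  exact: cvg_cst.
by apply: (@continuous_min _ _ id (cst T)); [exact: cvg_id|exact: cvg_cst].
Qed.

Lemma C0_timeP g : C0_time T g <-> continuous (g \o clamp).
Proof.
apply: within_continuous_retract; first exact: clamp_continuous.
  by move=> t; rewrite /= in_itv /= clamp_itv.
by move=> t; rewrite /= in_itv; exact: clamp_id.
Qed.

Lemma C0_stripP f :
  C0_strip T f <-> continuous (fun z : R * R => f (clamp z.1) z.2).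
Proof.
apply: (@within_continuous_retract _ _ (strip T) (fun z => (clamp z.1, z.2))
  (fun z => f z.1 z.2)).
- move=> z; apply: (@cvg_pair _ _ _ (nbhs z) (nbhs (clamp z.1)) (nbhs z.2) _ _ _
    (fun z => clamp z.1) snd); last exact: cvg_snd.
  apply: (@continuous_comp _ _ _ (@fst R R) clamp z); first exact: cvg_fst.
  exact: clamp_continuous.
- by move=> z; split=> //=; rewrite in_itv /= clamp_itv.
- by move=> [t x] [] /=; rewrite in_itv => /clamp_id ->.
Qed.

Lemma C0_strip_dist f t x e : C0_strip T f -> 0 <= t <= T -> 0 < e ->
  exists2 d, 0 < d & forall s y, 0 <= s <= T -> `|s - t| < d -> `|y - x| < d ->
    `|f s y - f t x| <= e.
Proof.
move=> /C0_stripP cf tT e0.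
have /cvgrPdist_le/(_ e e0) := cf (t, x).
rewrite nearE => /nbhs_ballP [d /= d0 sub]; exists d => // s y sT st yx.
have := sub (s, y); rewrite /= !clamp_id// distrC; apply.
by split=> /=; rewrite /ball /= distrC.
Qed.

Lemma C0_strip_slice f t : C0_strip T f -> 0 <= t <= T -> continuous (f t).
Proof.
move=> cf tT x; apply/cvgrPdist_le => e e0.
have [d d0 fd] := C0_strip_dist x cf tT e0.
apply/nbhs_normP; exists d => //= y xy.
by rewrite distrC; apply: fd => //; rewrite ?subrr ?normr0// distrC.
Qed.

Lemma C0_strip_comp1 (h : R -> R) f : continuous h -> C0_strip T f ->
  C0_strip T (fun t x => h (f t x)).
Proof.
by move=> ch /C0_stripP cf; apply/C0_stripP => z; apply: continuous_comp (cf z) (ch _).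
Qed.

Lemma C0_stripM f1 f2 : C0_strip T f1 -> C0_strip T f2 ->
  C0_strip T (fun t x => f1 t x * f2 t x).
Proof.
by move=> /C0_stripP c1 /C0_stripP c2; apply/C0_stripP => z; exact: cvgM (c1 z) (c2 z).
Qed.

Lemma C0_stripD f1 f2 : C0_strip T f1 -> C0_strip T f2 ->
  C0_strip T (fun t x => f1 t x + f2 t x).
Proof.
by move=> /C0_stripP c1 /C0_stripP c2; apply/C0_stripP => z; exact: cvgD (c1 z) (c2 z).
Qed.

Lemma C0_stripN f : C0_strip T f -> C0_strip T (fun t x => - f t x).
Proof. by move=> /C0_stripP cf; apply/C0_stripP => z; exact: cvgN (cf z). Qed.

Lemma C0_stripV f : (forall t x, 0 <= t <= T -> f t x != 0) -> C0_strip T f ->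
  C0_strip T (fun t x => (f t x)^-1).
Proof.
move=> f0 /C0_stripP cf; apply/C0_stripP => z; apply: cvgV (cf z).
by rewrite f0// clamp_itv.
Qed.

Lemma C0_strip_time g : C0_time T g -> C0_strip T (fun t _ => g t).
Proof.
move=> /C0_timeP cg; apply/C0_stripP => z.
by apply: (@continuous_comp _ _ _ fst (g \o clamp) z); [exact: cvg_fst|exact: cg].
Qed.

Lemma C0_strip_space g : continuous g -> C0_strip T (fun _ x => g x).
Proof.
move=> cg; apply/C0_stripP => z.
by apply: (@continuous_comp _ _ _ snd g z); [exact: cvg_snd|exact: cg].
Qed.

(** Punctured neighbourhoods that are one-sided at the ends of [[0, T]], along which
    time derivatives are taken. *)
Definition time_dnbhs t : set_system R := within `[0, T] t^'.

#[local] Instance time_dnbhs_filter t : Filter (time_dnbhs t).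
Proof. exact: within_filter. Qed.

Lemma cvg_near_eq (F : set_system R) {FF : Filter F} (f g : R -> R) l :
  f s @[s --> F] --> l -> (\forall s \near F, f s = g s) -> g s @[s --> F] --> l.
Proof. by move=> fl fg A /fl /=; rewrite !nbhs_simpl /=; apply: filterS2 fg => s /= ->. Qed.

Definition has_time_derive g t l : Prop :=
  time_quotient T g t s @[s --> time_dnbhs t] --> l.

Lemma time_derivableP g t :
  time_derivable T g t -> has_time_derive g t (time_derive T g t).
Proof. by []. Qed.

Lemma time_dnbhsP t (P : R -> Prop) :
  (\forall s \near time_dnbhs t, P s) <->
  exists2 d, 0 < d & forall s, 0 <= s <= T -> s != t -> `|s - t| < d -> P s.
Proof.
split.
  move=> /nbhs_normP[d /= d0 sub]; exists d => // s sT st sd.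
  by apply: sub => //=; rewrite distrC.
move=> [d d0 sub]; apply/nbhs_normP; exists d => //= s /= sd st.
by rewrite in_itv /= => sT; apply: sub => //; rewrite distrC.
Qed.

Lemma time_dnbhs_right t (P : R -> Prop) : 0 <= t < T ->
  (\forall s \near time_dnbhs t, P s) -> exists2 s, t < s <= T & P s.
Proof.
move=> /andP[t0 tT] /time_dnbhsP[d d0 sub].
pose s := Num.min T (t + d / 2).
have ts : t < s by rewrite /s lt_min tT /= ltrDl divr_gt0.
have sT : s <= T by rewrite /s ge_min lexx.
have sd : s <= t + d / 2 by rewrite /s ge_min lexx orbT.
exists s; first by rewrite ts.
apply: sub; rewrite ?sT ?andbT ?gt_eqF//; first lra.
rewrite gtr0_norm ?subr_gt0//; lra.
Qed.

Lemma time_dnbhs_proper t : 0 <= t <= T -> ProperFilter (time_dnbhs t).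
Proof.
move=> /andP[t0 tT]; apply: Build_ProperFilter_ex => P /time_dnbhsP[d d0 sub].
have [tlt|tge] := ltP t T.
  have tT' : 0 <= t < T by rewrite t0.
  have [s _ Ps] := time_dnbhs_right tT' ((time_dnbhsP t P).2 (ex_intro2 _ _ d d0 sub)).
  by exists s.
have t_gt0 := lt_le_trans T0 tge.
exists (Num.max 0 (t - d / 2)); apply: sub.
- by rewrite le_max lexx /= ge_max (le_trans t0)//=; lra.
- by rewrite lt_eqF// gt_max t_gt0 /=; lra.
- have m : t - d / 2 <= Num.max 0 (t - d / 2) by rewrite le_max lexx orbT.
  rewrite ltr0_norm; first lra.
  by rewrite subr_lt0 gt_max t_gt0 /=; lra.
Qed.

Lemma has_time_derive_val g t l : 0 <= t <= T ->
  has_time_derive g t l -> time_derive T g t = l.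
Proof.
move=> tT gl; have P := time_dnbhs_proper tT.
by apply: cvg_lim => //; exact: Rhausdorff.
Qed.

Lemma has_time_derive_derivable g t l :
  has_time_derive g t l -> time_derivable T g t.
Proof. by move=> gl; apply/cvg_ex; exists l. Qed.

Lemma has_time_derive_cvg g t l :
  has_time_derive g t l -> g s @[s --> time_dnbhs t] --> g t.
Proof.
move=> gl.
have st : (s - t) @[s --> time_dnbhs t] --> (0 : R).
  rewrite -(subrr t); apply: cvgB; last exact: cvg_cst.
  by apply: (@cvg_trans _ (nbhs (t^'))); apply: cvg_within.
pose proof (cvgD (cvg_cst (g t)) (cvgM gl st)) as X.
rewrite mulr0 addr0 in X; apply: (cvg_near_eq X).
apply/time_dnbhsP; exists 1 => // s _ sNt _.
by rewrite /= /time_quotient /= divfK ?subr_eq0// addrC subrK.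
Qed.

Lemma has_time_deriveM g1 g2 t l1 l2 :
  has_time_derive g1 t l1 -> has_time_derive g2 t l2 ->
  has_time_derive (fun s => g1 s * g2 s) t (l1 * g2 t + g1 t * l2).
Proof.
move=> d1 d2; have c2 := has_time_derive_cvg d2.
pose proof (cvgD (cvgM d1 c2) (cvgM (cvg_cst (g1 t)) d2)) as X.
apply: (cvg_near_eq X); near=> s.
by rewrite /= /time_quotient /=; ring.
Unshelve. all: by end_near. Qed.

Lemma has_time_deriveB g1 g2 t l1 l2 :
  has_time_derive g1 t l1 -> has_time_derive g2 t l2 ->
  has_time_derive (fun s => g1 s - g2 s) t (l1 - l2).
Proof.
move=> d1 d2; pose proof (cvgB d1 d2) as X.
apply: (cvg_near_eq X); near=> s.
by rewrite /= opprfctE /time_quotient /=; ring.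
Unshelve. all: by end_near. Qed.

Lemma has_time_derive_comp (h : R -> R) g t l :
  derivable h (g t) 1 -> has_time_derive g t l ->
  has_time_derive (h \o g) t (derive1 h (g t) * l).
Proof.
move=> dh gl.
have [k [hk ck <-]] := (is_derive1_caratheodory _ _ _).1 (derivable_is_derive1 dh).
have kg : k (g s) @[s --> time_dnbhs t] --> k (g t).
  exact: cvg_comp (has_time_derive_cvg gl) ck.
pose proof (cvgM kg gl) as X; apply: (cvg_near_eq X); near=> s.
by rewrite /time_quotient /= hk mulrA.
Unshelve. all: by end_near. Qed.

(** Chain rule along a straight line of slope [c]. Only the space derivative has to
    be jointly continuous: the increment splits into one in [t] alone, and one in
    [x] alone at the new time, to which the mean value theorem applies. *)
Lemma has_time_derive_line f t x c l :
  C0_strip T (px f) -> (forall s y, 0 <= s <= T -> derivable (f s) y 1) ->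
  0 <= t <= T -> has_time_derive (f^~ x) t l ->
  has_time_derive (fun s => f s (x + c * (s - t))) t (l + c * px f t x).
Proof.
move=> cpx dx tT fl.
suff D : (f s (x + c * (s - t)) - f s x) / (s - t) @[s --> time_dnbhs t]
    --> c * px f t x.
  pose proof (cvgD fl D) as X; apply: (cvg_near_eq X); near=> s.
  by rewrite /= /time_quotient subrr mulr0 addr0 -mulrDl; congr (_ / _); ring.
apply/cvgrPdist_le => e e0.
have c1 : 0 < `|c| + 1 by rewrite ltr_wpDl.
have [d d0 fd] := C0_strip_dist x cpx tT (divr_gt0 e0 c1).
apply/time_dnbhsP; exists (d / (`|c| + 1)); first by rewrite divr_gt0.
move=> s sT sNt; rewrite ltr_pdivlMr// => sd.
have st0 : s - t != 0 by rewrite subr_eq0.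
have [xi xi_le ->] : exists2 xi, `|xi - x| <= `|c * (s - t)| &
    f s (x + c * (s - t)) - f s x = px f s xi * (c * (s - t)).
  have [cs|cs] := leP 0 (c * (s - t)).
    have [|xi /andP[x1 x2] e1] := @MVT_line _ (f s) x (x + c * (s - t)) (fun y => dx s y sT).
      by rewrite lerDl.
    exists xi; last by rewrite e1; congr (_ * _); ring.
    by rewrite !ger0_norm ?subr_ge0// lerBlDl.
  have [|xi /andP[x1 x2] e1] := @MVT_line _ (f s) (x + c * (s - t)) x (fun y => dx s y sT).
    by rewrite gerDl ltW.
  exists xi; last by rewrite -opprB e1 -mulrN; congr (_ * _); ring.
  by rewrite (ltr0_norm cs) ler0_norm ?subr_le0//; lra.
rewrite mulrA mulfK// mulrC -mulrBl normrM.
have xid : `|xi - x| < d.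
  apply: le_lt_trans xi_le _; rewrite normrM; apply: le_lt_trans sd.
  by rewrite mulrC ler_wpM2l// lerDl.
have std : `|s - t| < d.
  by apply: le_lt_trans sd; rewrite ler_peMr// lerDr.
have := fd s xi sT std xid; rewrite distrC ler_pdivlMr// => h.
by apply: le_trans h; rewrite ler_wpM2l// lerDl.
Unshelve. all: by end_near. Qed.

(** * Transport along characteristics *)

(** Continuity principle: a compact set of times that can always be left to the
    right reaches [b], since its largest element cannot be smaller. *)
Lemma compact_reach (A : set R) a b :
  compact A -> A a -> (forall s, A s -> s <= b) ->
  (forall s, A s -> s < b -> exists2 s', A s' & s < s') -> A b.
Proof.
move=> cA Aa Ab step.
have [|c /set_mem Ac cmax] := @compact_EVT_max _ R id A (ex_intro _ a Aa) cA.
  by apply: continuous_subspaceT => x; exact: cvg_id.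
have := Ab _ Ac; rewrite le_eqVlt => /orP[/eqP <-//|cb].
have [s' As' cs'] := step _ Ac cb.
by have := cmax s' (mem_set As'); rewrite leNgt cs'.
Qed.

(** For each [e' > 0], the times [s] with [g s <= g a + e' * (s - a)] form a set to
    which the continuity principle applies. *)
Lemma time_derive_le0_nonincreasing g a b : 0 <= a -> a <= b -> b <= T -> C0_time T g ->
  (forall t, a <= t < b -> exists2 l, l <= 0 & has_time_derive g t l) ->
  g b <= g a.
Proof.
move=> a0 ab bT cg dg; apply/ler_addgt0Pr => e e0.
pose e' := e / (b - a + 1).
have e'0 : 0 < e' by rewrite divr_gt0// ltr_wpDl// subr_ge0.
pose A := [set s | a <= s <= b /\ g s <= g a + e' * (s - a)].
suff [_ /le_trans] : A b.
  apply; rewrite lerD2l /e' mulrAC ler_pdivrMr ?ltr_wpDl ?subr_ge0//.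
  by rewrite ler_wpM2l ?(ltW e0)// lerDl.
apply: (@compact_reach A a b).
- have -> : A = `[a, b] `&` [set s | g (clamp s) - e' * (s - a) <= g a].
    apply/seteqP; split => s [] /=; rewrite ?in_itv /= => sab.
      by rewrite clamp_id ?lerBlDr//; lra.
    by rewrite clamp_id ?lerBlDr//; move: sab; lra.
  apply: compact_closedI; first exact: segment_compact.
  apply: (@closed_comp _ _ (fun s => g (clamp s) - e' * (s - a)) [set y | y <= g a]).
    move=> s _; apply: cvgB; first exact: (C0_timeP g).1.
    by apply: cvgM; [exact: cvg_cst|apply: cvgB; [exact: cvg_id|exact: cvg_cst]].
  exact: closed_le.
- by split; rewrite ?lexx// subrr mulr0 addr0.
- by move=> s [/andP[]].
move=> s [/andP[as_ sb] gs] sltb.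
have [|l l0 gl] := dg s; first by rewrite as_.
have sT : 0 <= s < T by apply/andP; split; lra.
have slope : \forall u \near time_dnbhs s, time_quotient T g s u < e'.
  exact: (cvgr_lt _ gl _ (le_lt_trans l0 e'0)).
have close : \forall u \near time_dnbhs s, u < b.
  apply/time_dnbhsP; exists (b - s); first lra.
  by move=> u _ _; rewrite ltr_distl; lra.
have [u /andP[su uT] [gu ub]] := time_dnbhs_right sT (filterI slope close).
exists u => //; split; first lra.
move: gu; rewrite /time_quotient ltr_pdivrMr ?subr_gt0//; lra.
Qed.

(** A maximum principle for the transport equation [q_t + a(q) q_x = O(A)] with
    data at time [T]. The solution moves by at most [A] per unit of time along
    the characteristics, so that its values are controlled by those at time [T].
    Nothing bounds [q], hence the speed [a(q)], beforehand; but the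
    characteristic issued from [(t0, x0)] only meets values of [q] at distance
    at most [(A + 1) * T] from [q t0 x0], on which [`|a|] is bounded by some [S].
    The characteristic itself is not constructed: the points that a cone of slope
    [S] and the bound [(A + 1) * (t - t0)] on the increment of [q] allow form a
    compact set [E], in which a small step in the characteristic direction
    always leads to a later time, the excess of the rate [A + 1] over [A]
    absorbing the error; so [E] reaches time [T]. *)
Lemma transport_bound (q : R -> R -> R) (a : R -> R) (A B : R) :
  C0_strip T q -> C0_strip T (px q) ->
  (forall s y, 0 <= s <= T -> derivable (q s) y 1) ->
  continuous a ->
  (forall t x, 0 <= t <= T -> exists2 l, has_time_derive (q^~ x) t l &
     `|l + a (q t x) * px q t x| <= A) ->
  (forall x, `|q T x| <= B) ->
  forall t x, 0 <= t <= T -> `|q t x| <= B + (A + 1) * T.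
Proof.
move=> cq cqx dq ca qt qT t0 x0 /andP[t00 t0T].
set q0 := q t0 x0.
have A0 : 0 <= A.
  have [|l _] := qt 0 0; first by rewrite lexx ltW.
  exact: le_trans.
pose D := (A + 1) * T.
have D0 : 0 <= D by rewrite mulr_ge0 ?ltW// ltr_wpDl.
have [S S0 aS] : exists2 S, 0 <= S & forall p, `|p - q0| <= D -> `|a p| <= S.
  have [||c _ cm] := @EVT_max R (fun p => `|a p|) (q0 - D) (q0 + D).
  - lra.
  - by apply: continuous_subspaceT => p; apply: cvg_norm; exact: ca.
  - exists `|a c| => // p; rewrite ler_distl => pD; apply: cm.
    by rewrite in_itv.
have tT t : t0 <= t <= T -> 0 <= t <= T.
  by move=> /andP[h ->]; rewrite (le_trans t00).
pose E := [set z : R * R | [/\ t0 <= z.1 <= T, `|z.2 - x0| <= S * (z.1 - t0) &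
  `|q z.1 z.2 - q0| <= (A + 1) * (z.1 - t0)]].
have cE : compact E.
  have -> : E = (`[t0, T] `*` `[x0 - S * T, x0 + S * T]) `&`
      ([set z | `|z.2 - x0| - S * (z.1 - t0) <= 0] `&`
       [set z | `|q (clamp z.1) z.2 - q0| - (A + 1) * (z.1 - t0) <= 0]).
    apply/seteqP; split => -[t x] /=.
      move=> [tt xx qq]; rewrite clamp_id ?tT// !subr_le0; split=> //.
      split; rewrite in_itv //= -ler_distl.
      apply: le_trans xx _; rewrite ler_wpM2l//.
      by move: tt => /andP[]; lra.
    rewrite !in_itv /= !subr_le0 => -[[tt _] [xx qq]]; split=> //.
    by move: qq; rewrite clamp_id ?tT.
  apply: compact_closedI.
    by apply: compact_setX; exact: segment_compact.
  have cfst : continuous (@fst R R) by move=> z; exact: cvg_fst.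
  have csnd : continuous (@snd R R) by move=> z; exact: cvg_snd.
  have ct k : continuous (fun z : R * R => k * (z.1 - t0)).
    by move=> z; apply: cvgM; [exact: cvg_cst|apply: cvgB; [exact: cfst|exact: cvg_cst]].
  apply: closedI.
    apply: (@closed_comp _ _ (fun z : R * R => `|z.2 - x0| - S * (z.1 - t0))
      [set y | y <= 0]); last exact: closed_le.
    move=> z _; apply: cvgB; last exact: ct.
    by apply: cvg_norm; apply: cvgB; [exact: csnd|exact: cvg_cst].
  apply: (@closed_comp _ _
    (fun z : R * R => `|q (clamp z.1) z.2 - q0| - (A + 1) * (z.1 - t0))
    [set y | y <= 0]); last exact: closed_le.
  move=> z _; apply: cvgB; last exact: ct.
  by apply: cvg_norm; apply: cvgB; [exact: (C0_stripP _).1|exact: cvg_cst].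
(* A point of [E] at time [T] compares [q t0 x0] with the terminal data. *)
suff [[t x] [_ _]] : (fst @` E) T.
  move=> /= qq tE; rewrite {}tE in qq.
  have := qT x; have := ler_normD (q T x) (q0 - q T x); rewrite [X in `|X|]addrC subrK.
  rewrite (distrC q0) => h1 h2.
  apply: le_trans h1 _; apply: lerD => //; apply: le_trans qq _.
  by rewrite ler_wpM2l//; lra.
apply: (@compact_reach _ t0 T).
- by apply: continuous_compact => //; apply: continuous_subspaceT => z; exact: cvg_fst.
- by exists (t0, x0) => //; split; rewrite /= ?lexx ?t0T// !subrr mulr0 normr0.
- by move=> _ [z [/andP[]] _ zT _ _ <-].
move=> _ [[t x] [/= t0t xx qq] <-] tltT.
have [t0t' _] := andP t0t.
have [l ql lA] := qt t x (tT _ t0t).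
(* The characteristic direction at [(t, x)]; it lies in the cone because [E] keeps
   [q t x] within [D] of [q0]. *)
set c := a (q t x) in lA.
have cS : `|c| <= S.
  by apply: aS; apply: le_trans qq _; rewrite ler_wpM2l//; lra.
have dl := @has_time_derive_line q t x c l cqx dq (tT _ t0t) ql.
have tT' : 0 <= t < T by rewrite tltT (le_trans t00).
have slope : \forall u \near time_dnbhs t,
    `|time_quotient T (fun s => q s (x + c * (s - t))) t u| < A + 1.
  by apply: (cvgr_lt _ (cvg_norm dl)); apply: le_lt_trans lA _; rewrite ltrDl.
have [u /andP[tu uT]] := time_dnbhs_right tT' slope.
rewrite /time_quotient subrr mulr0 addr0 normrM normfV ltr_pdivrMr; last first.
  by rewrite normr_gt0 subr_eq0 gt_eqF.
rewrite (@ger0_norm _ (u - t)) ?subr_ge0 ?(ltW tu)// => qu.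
exists u => //; exists (u, x + c * (u - t)) => //; split => /=.
- by rewrite uT andbT (le_trans _ (ltW tu)).
- have -> : x + c * (u - t) - x0 = (x - x0) + c * (u - t) by ring.
  apply: le_trans (ler_normD _ _) _; rewrite normrM (@ger0_norm _ (u - t)) ?subr_ge0 ?(ltW tu)//.
  have : `|c| * (u - t) <= S * (u - t) by rewrite ler_wpM2r// subr_ge0 ltW.
  lra.
- have -> : q u (x + c * (u - t)) - q0 = (q u (x + c * (u - t)) - q t x) + (q t x - q0) by ring.
  by apply: le_trans (ler_normD _ _) _; lra.
Qed.

End StripCalculus.

Section FiniteSpeed.
Set Implicit Arguments.
Unset Strict Implicit.
Context {R : realType} (T : R).
Hypothesis T0 : 0 < T.
Implicit Types (t s x l : R) (g : R -> R) (f phi : R -> R -> R).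

Lemma has_time_deriveN g t l :
  has_time_derive T g t l -> has_time_derive T (fun s => - g s) t (- l).
Proof.
move=> d1; pose proof (cvgN d1) as X; apply: (cvg_near_eq X); near=> s.
by rewrite /= /time_quotient /=; ring.
Unshelve. all: by end_near. Qed.

Lemma time_derivable_continuous g :
  (forall t, 0 <= t <= T -> exists l, has_time_derive T g t l) -> C0_time T g.
Proof.
move=> dg; apply/subspace_continuousP => t; rewrite /= in_itv /= => tT.
have [l gl] := dg t tT.
have /cvgrPdist_lt gc := has_time_derive_cvg gl.
apply/cvgrPdist_lt => e /[dup] e0 /gc /time_dnbhsP[d d0 sub].
apply/nbhs_normP; exists d => //= s ts; rewrite in_itv /= => sT.
have [->|st] := eqVneq s t; first by rewrite subrr normr0.
by apply: sub => //; rewrite distrC.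
Qed.

(** Finite speed of propagation: [phi] is monotone along the lines of slope
    [M] and [- M], because [`|phi_t| <= M phi_x]. *)
Lemma finite_speed phi (M : R) t x : C1_strip T phi -> 0 <= t <= T ->
  (forall s y, 0 <= s <= T -> `|pt T phi s y| <= M * px phi s y) ->
  phi 0 (x - M * t) <= phi t x <= phi 0 (x + M * t).
Proof.
move=> [_ dphi _ cpx] tT speed; have [t0 t_T] := andP tT.
have line c y s : 0 <= s <= T -> has_time_derive T (fun u => phi u (y + c * u)) s
    (pt T phi s (y + c * s) + c * px phi s (y + c * s)).
  move=> sT.
  have := @has_time_derive_line _ T T0 phi s (y + c * s) c _ cpx
    (fun s y sT => (dphi s y sT).2) sT (time_derivableP (dphi s _ sT).1).
  by congr has_time_derive; apply/funext => u; congr (phi u); ring.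
apply/andP; split.
  have -> : phi 0 (x - M * t) = phi 0 ((x - M * t) + M * 0) by rewrite mulr0 addr0.
  have -> : phi t x = phi t ((x - M * t) + M * t) by rewrite subrK.
  rewrite -lerN2; apply: (@time_derive_le0_nonincreasing _ T T0
    (fun u => - phi u ((x - M * t) + M * u)) 0 t) => //.
    by apply: time_derivable_continuous => s sT; eexists; apply/has_time_deriveN/line.
  move=> s /andP[s0 st]; have sT : 0 <= s <= T by rewrite s0 (le_trans (ltW st)).
  eexists; last by apply/has_time_deriveN/line.
  have := speed s (x - M * t + M * s) sT; rewrite ler_norml => /andP[h _].
  by move: h; lra.
have -> : phi 0 (x + M * t) = phi 0 ((x + M * t) + (- M) * 0) by rewrite mulr0 addr0.
have -> : phi t x = phi t ((x + M * t) + (- M) * t) by congr (phi t); ring.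
apply: (@time_derive_le0_nonincreasing _ T T0
  (fun u => phi u ((x + M * t) + (- M) * u)) 0 t) => //.
  by apply: time_derivable_continuous => s sT; eexists; apply/line.
move=> s /andP[s0 st]; have sT : 0 <= s <= T by rewrite s0 (le_trans (ltW st)).
eexists; last by apply/line.
have := speed s (x + M * t + - M * s) sT; rewrite ler_norml => /andP[_ h].
by move: h; lra.
Qed.

End FiniteSpeed.

Section StripComplements.
Set Implicit Arguments.
Unset Strict Implicit.
Context {R : realType}.

Lemma time_derive_eq_in (T : R) (g1 g2 : R -> R) (t : R) : 0 <= t <= T ->
  (forall s, 0 <= s <= T -> g1 s = g2 s) -> time_derive T g1 t = time_derive T g2 t.
Proof.
move=> tT g12; rewrite /time_derive; congr (lim _).
have q12 s : 0 <= s <= T -> time_quotient T g1 t s = time_quotient T g2 t s.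
  by move=> sT; rewrite /time_quotient !g12.
apply/seteqP; split => A /time_dnbhsP[d d0 sub]; apply/time_dnbhsP; exists d => // s sT st sd.
  by rewrite /= -q12 //; exact: sub.
by rewrite /= q12 //; exact: sub.
Qed.

Lemma eq_C0_strip (T : R) (f1 f2 : R -> R -> R) : 0 < T ->
  (forall t x, 0 <= t <= T -> f1 t x = f2 t x) -> C0_strip T f1 -> C0_strip T f2.
Proof.
move=> T0 e /(C0_stripP T0) c1; apply/(C0_stripP T0).
have <- : (fun z : R * R => f1 (clamp T z.1) z.2) = (fun z => f2 (clamp T z.1) z.2).
  by apply/funext => z; rewrite e// clamp_itv.
exact: c1.
Qed.

(** The zero direction, along which only the multiplier [w] varies. *)
Lemma C1c_strip0 (T : R) : 0 < T -> C1c_strip T (fun _ _ : R => 0 : R).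
Proof.
move=> T0.
have has0 t : has_time_derive T (fun=> 0) t 0.
  rewrite /has_time_derive (_ : time_quotient T (fun=> 0) t = cst 0); first exact: cvg_cst.
  by apply/funext => s; rewrite /time_quotient subrr mul0r.
have c0 : C0_strip T (fun _ _ : R => 0 : R) by apply: C0_strip_space => //; exact: cst_continuous.
have supp0 : strip_support T (fun _ _ : R => 0 : R) = set0.
  rewrite /strip_support (_ : [set z | _] = set0) ?closure0//.
  by apply/seteqP; split=> // z [_]; rewrite eqxx.
split; last 2 first.
- by rewrite supp0; exact: compact0.
- by rewrite supp0.
split=> //.
- move=> t x _; split; first exact: has_time_derive_derivable (has0 t).
  exact: derivable_cst.
- apply: (eq_C0_strip T0 _ c0) => t x tT.
  by rewrite /pt (has_time_derive_val T0 tT (has0 t)).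
- apply: (eq_C0_strip T0 _ c0) => t x tT.
  by rewrite /px (is_derive1_val (is_derive_cst (0 : R) x 1)).
Qed.

End StripComplements.

(** * Integrals over the line *)

Section Integrals.
Set Implicit Arguments.
Unset Strict Implicit.
Context {R : realType}.
Local Notation mu := (@lebesgue_measure R).
Implicit Types (f g m : R -> R).

Definition sym_itv (n : nat) : set R := `[- n%:R, n%:R]%classic.

Lemma measurable_sym_itv n : measurable (sym_itv n).
Proof. exact: measurable_itv. Qed.

Lemma sym_itvP n (x : R) : sym_itv n x <-> `|x| <= n%:R.
Proof. by rewrite /sym_itv /= in_itv /= ler_norml. Qed.

Lemma nondecreasing_sym_itv : nondecreasing_seq sym_itv.
Proof.
move=> i j ij; apply/subsetPset => x /sym_itvP xi; apply/sym_itvP.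
by rewrite (le_trans xi)// ler_nat.
Qed.

Lemma bigcup_sym_itv : \bigcup_n sym_itv n = setT.
Proof.
apply/seteqP; split=> // x _; exists (Num.bound `|x|) => //.
apply/sym_itvP; exact: (ltW (archi_boundP (normr_ge0 x))).
Qed.

Lemma continuous_emeasurable f (D : set R) :
  continuous f -> measurable_fun D (EFin \o f).
Proof.
move=> cf; apply/measurable_EFinP; apply: measurable_funTS.
exact: continuous_measurable_fun.
Qed.

Lemma cvg_integral_sym_itv (f : R -> \bar R) : measurable_fun setT f ->
  (forall x, 0 <= f x)%E ->
  (\int[mu]_(x in sym_itv n) f x)%E @[n --> \oo] --> (\int[mu]_x f x)%E.
Proof.
move=> mf f0; rewrite -bigcup_sym_itv.
apply: ge0_nondecreasing_set_cvg_integral.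
- exact: nondecreasing_sym_itv.
- exact: measurable_sym_itv.
- by move=> i; apply: measurable_funTS.
- by move=> i x _; exact: f0.
Qed.

Lemma le_Rintegral_subset f (A B : set R) : measurable A -> measurable B ->
  (forall x, 0 <= f x) -> mu.-integrable setT (EFin \o f) -> A `<=` B ->
  \int[mu]_(x in A) f x <= \int[mu]_(x in B) f x.
Proof.
move=> mA mB f0 fi AB.
have iA : mu.-integrable A (EFin \o f) by apply: integrableS fi.
have iB : mu.-integrable B (EFin \o f) by apply: integrableS fi.
apply: fine_le; [exact: integrable_fin_num|exact: integrable_fin_num|].
apply: ge0_subset_integral => //; first exact: measurable_int iB.
by move=> x _; rewrite /= lee_fin.
Qed.

Lemma cvg_Rintegral_sym_itv f : (forall x, 0 <= f x) ->
  mu.-integrable setT (EFin \o f) ->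
  \int[mu]_(x in sym_itv n) f x @[n --> \oo] --> \int[mu]_x f x.
Proof.
move=> f0 fi.
have h : (\int[mu]_(x in sym_itv n) (f x)%:E)%E @[n --> \oo]
    --> (\int[mu]_x f x)%:E.
  rewrite /Rintegral fineK; last exact: integrable_fin_num.
  apply: cvg_integral_sym_itv; first exact: measurable_int fi.
  by move=> x; rewrite lee_fin.
by have [_] := (fine_cvgP _ _).1 h.
Qed.

Lemma density_integrable m : continuous m -> probability_density m ->
  mu.-integrable setT (EFin \o m).
Proof.
move=> cm [m0 m1]; apply/integrableP; split; first exact: continuous_emeasurable.
rewrite (_ : (fun x => _) = (EFin \o m)) ?m1 ?ltry//.
by apply/funext => x /=; rewrite ger0_norm.
Qed.

Lemma cdf_itv01 m (x : R) : continuous m -> probability_density m ->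
  0 <= \int[mu]_(y in `]-oo, x]) m y <= 1.
Proof.
move=> cm pm; have im := density_integrable cm pm; have [m0 m1] := pm.
rewrite Rintegral_ge0//=.
have -> : 1 = \int[mu]_x m x by rewrite /Rintegral m1.
by apply: le_Rintegral_subset.
Qed.

Lemma density_tails m (e : R) :
  continuous m -> probability_density m -> 0 < e -> exists n : nat, forall x, n%:R < x ->
    \int[mu]_(y in `]-oo, (- x)]) m y <= e /\ 1 - e <= \int[mu]_(y in `]-oo, x]) m y.
Proof.
move=> cm pm e0; have im := density_integrable cm pm; have [m0 m1] := pm.
have M1 : \int[mu]_x m x = 1 by rewrite /Rintegral m1.
have := cvg_Rintegral_sym_itv m0 im; rewrite M1 => /cvgr_gt/(_ (1 - e)).
case; first by rewrite ltrBlDr ltrDl.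
move=> n _ /(_ n (leqnn n)) /ltW me; exists n => x nx.
split; last first.
  apply: le_trans me _; apply: le_Rintegral_subset => //.
  - exact: measurable_sym_itv.
  - by move=> y; rewrite /sym_itv /= !in_itv /=; move=> /andP[_ yn]; exact: le_trans yn (ltW nx).
have d : [disjoint `]-oo, (- x)]%classic & sym_itv n].
  apply/disj_setPS => y; rewrite /sym_itv /= !in_itv /= => -[yx /andP[ny _]].
  by have := le_trans ny yx; rewrite lerN2 leNgt nx.
have mU : measurable (`]-oo, (- x)]%classic `|` sym_itv n).
  by apply: measurableU => //; exact: measurable_sym_itv.
have := le_Rintegral_subset mU measurableT m0 im (@subsetT _ _).
rewrite M1 Rintegral_setU//; first lra.
- exact: measurable_sym_itv.
- by apply: integrableS im.
Qed.

Lemma integral_derive1_itv (p F : R -> R) (n : nat) : (0 < n)%N ->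
  continuous p -> (forall x, derivable F x 1) -> (forall x, derive1 F x = p x) ->
  (\int[mu]_(x in sym_itv n) (p x)%:E = (F n%:R - F (- n%:R))%:E)%E.
Proof.
move=> n0 cp dF Fp.
have cF := derivable_continuousT dF.
rewrite /sym_itv (@continuous_FTC2 _ p F); first by rewrite EFinB.
- by rewrite gtrN// ltr0n.
- exact: continuous_subspaceT.
- split; first by move=> x _; exact: dF.
  + by apply: cvg_at_right_filter; exact: cF.
  + by apply: cvg_at_left_filter; exact: cF.
- by move=> x _; exact: Fp.
Qed.

(** The mass of [p] outside [[- n, n]] is what the increment of the distribution
    function [F] over [[- n, n]] misses of its largest possible value [1]. *)
Lemma distribution_integrable (p F : R -> R) :
  continuous p -> (forall x, derivable F x 1) -> (forall x, derive1 F x = p x) ->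
  (forall x, 0 <= p x) -> (forall x, 0 <= F x <= 1) ->
  mu.-integrable setT (EFin \o p) /\
  forall n, (0 < n)%N ->
    \int[mu]_(x in ~` sym_itv n) p x <= 1 - (F n%:R - F (- n%:R)).
Proof.
move=> cp dF Fp p0 F01.
have le1 : (\int[mu]_x (p x)%:E <= 1)%E.
  have h := @cvg_integral_sym_itv (EFin \o p) (continuous_emeasurable cp)
    (fun x => p0 x : (0%:E <= (p x)%:E)%E).
  rewrite -(cvg_lim _ h)//; apply: lime_le; first by apply/cvg_ex; eexists; exact: h.
  exists 1 => // n n1; rewrite /= (integral_derive1_itv n1 cp dF Fp) lee_fin.
  have := F01 n%:R; have := F01 (- n%:R); lra.
have ip : mu.-integrable setT (EFin \o p).
  apply/integrableP; split; first exact: continuous_emeasurable.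
  rewrite (_ : (fun x => _) = (EFin \o p)); first by rewrite (le_lt_trans le1)// ltry.
  by apply/funext => x /=; rewrite ger0_norm.
split=> // n n0.
have mS := measurable_sym_itv n.
have := @Rintegral_setU _ _ _ mu (sym_itv n) (~` sym_itv n) p mS (measurableC mS).
rewrite setUv disj_set2E setICr => /(_ ip)/(_ (eqxx _)) e.
have : \int[mu]_x p x <= 1.
  rewrite -lee_fin /Rintegral fineK//; exact: integrable_fin_num.
by rewrite e {1}/Rintegral (integral_derive1_itv n0 cp dF Fp) /= lerBrDl.
Qed.

End Integrals.

(** * Integrals depending on time *)

Section ParamIntegrals.
Set Implicit Arguments.
Unset Strict Implicit.
Context {R : realType} (T : R).
Hypothesis T0 : 0 < T.
Local Notation mu := (@lebesgue_measure R).
Implicit Types (t x : R) (f : R -> R -> R).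

Lemma compact_sym_itv n : compact (@sym_itv R n).
Proof. exact: segment_compact. Qed.

Lemma C0_strip_bounded f n : C0_strip T f ->
  exists K, forall t x, sym_itv n x -> `|f (clamp T t) x| <= K.
Proof.
move=> /(C0_stripP T0) cf.
have [|||z _ zmax] := @compact_EVT_max _ R (fun z : R * R => `|f (clamp T z.1) z.2|)
   (`[0, T]%classic `*` @sym_itv R n).
- exists (0, 0); split; first by rewrite /= in_itv /= lexx ltW.
  by apply/sym_itvP; rewrite normr0.
- by apply: compact_setX; [exact: segment_compact|exact: compact_sym_itv].
- by apply: continuous_subspaceT => z; apply: cvg_norm; exact: cf.
exists `|f (clamp T z.1) z.2| => t x nx.
have := zmax (clamp T t, x); rewrite /= (clamp_id (clamp_itv T0 t)); apply.
by apply/mem_set; split=> //=; rewrite in_itv /= clamp_itv.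
Qed.

Lemma C0_time_bounded (g : R -> R) : C0_time T g ->
  exists K, forall t, 0 <= t <= T -> `|g t| <= K.
Proof.
move=> cg; have [K gK] := C0_strip_bounded 0 (C0_strip_time T0 cg).
exists K => t tT; have := gK t 0; rewrite (clamp_id tT); apply.
by apply/sym_itvP; rewrite normr0.
Qed.

Lemma C0_time_integral_sym_itv f n : C0_strip T f ->
  C0_time T (fun t => \int[mu]_(x in sym_itv n) f t x).
Proof.
move=> cf; apply/(C0_timeP T0) => t.
have [K fK] := C0_strip_bounded n cf.
have cfc := (C0_stripP T0 f).1 cf.
have slice s : continuous (f (clamp T s)).
  exact: C0_strip_slice cf (clamp_itv T0 s).
apply: (@continuity_under_integral R _ _ mu (fun t x => f (clamp T t) x)
  (sym_itv n) (measurable_sym_itv n) (t - 1) (t + 1) _ _ (cst K)).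
- move=> s _; apply: continuous_compact_integrable; first exact: compact_sym_itv.
  exact: (continuous_subspaceT (slice s)).
- apply: aeW => x _ s _.
  apply: (@continuous_comp _ _ _ (fun s => (s, x))
    (fun z : R * R => f (clamp T z.1) z.2)); last exact: cfc.
  by apply: (@cvg_pair _ _ _ (nbhs s) (nbhs s) (nbhs x) _ _ _ id (cst x));
    [exact: cvg_id|exact: cvg_cst].
- apply: continuous_compact_integrable; first exact: compact_sym_itv.
  by apply: continuous_subspaceT => x; exact: cvg_cst.
- by move=> s _; apply: aeW => x nx; exact: fK.
- by apply/mem_set; rewrite /= in_itv /=; apply/andP; split; lra.
Qed.

Lemma C0_time_distP (g : R -> R) : C0_time T g <->
  forall t e, 0 <= t <= T -> 0 < e -> exists2 d, 0 < d &
    forall s, 0 <= s <= T -> `|s - t| < d -> `|g s - g t| <= e.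
Proof.
split=> [cg t e tT e0|cg].
  have [d d0 gd] := C0_strip_dist T0 0 (C0_strip_time T0 cg) tT e0.
  by exists d => // s sT sd; apply: (gd s 0); rewrite ?subrr ?normr0.
apply/subspace_continuousP => t; rewrite /= in_itv /= => tT.
apply/cvgrPdist_le => e e0; have [d d0 gd] := cg t e tT e0.
apply/nbhs_normP; exists d => //= s ts; rewrite in_itv /= => sT.
by rewrite distrC; apply: gd => //; rewrite distrC.
Qed.

(** Uniform tightness: up to [e / 3], the integral is one over a fixed compact
    interval, which depends continuously on time. *)
Lemma C0_time_integral f : C0_strip T f ->
  (forall t, 0 <= t <= T -> mu.-integrable setT (EFin \o f t)) ->
  (forall e, 0 < e -> exists n : nat, forall t, 0 <= t <= T ->
     `|\int[mu]_(x in ~` sym_itv n) f t x| <= e) ->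
  C0_time T (fun t => \int[mu]_x f t x).
Proof.
move=> cf fi tail; apply/C0_time_distP => t e tT e0.
have e3 : 0 < e / 3 by rewrite divr_gt0.
have [n ntail] := tail _ e3.
have [d d0 fd] := (C0_time_distP _).1 (@C0_time_integral_sym_itv f n cf) t _ tT e3.
exists d => // s sT st; have near_s := fd s sT st.
have split_int u : 0 <= u <= T -> \int[mu]_x f u x =
    \int[mu]_(x in sym_itv n) f u x + \int[mu]_(x in ~` sym_itv n) f u x.
  move=> uT; have mS := @measurable_sym_itv R n.
  have := @Rintegral_setU _ _ _ mu (sym_itv n) (~` sym_itv n) (f u) mS (measurableC mS).
  by rewrite setUv disj_set2E setICr => /(_ (fi u uT))/(_ (eqxx _)).
rewrite !split_int//.
have tail_t := ntail _ tT; have tail_s := ntail _ sT.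
set a := Rintegral _ _ _ in near_s *; set b := Rintegral _ _ _ in near_s *.
set a' := Rintegral _ _ _ in tail_s *; set b' := Rintegral _ _ _ in tail_t *.
have -> : a + a' - (b + b') = (a - b) + (a' - b') by ring.
have := ler_normD (a - b) (a' - b'); have := ler_normB a' b'; lra.
Qed.

Lemma ge0_measurable_integral f : C0_strip T f -> (forall t x, 0 <= f t x) ->
  measurable_fun `[0, T] (fun t => (\int[mu]_x (f t x)%:E)%E).
Proof.
move=> cf f0.
apply: (@emeasurable_fun_cvg _ _ _ _ (fun n t => \int[mu]_(x in sym_itv n) (f t x)%:E)%E).
  move=> n; apply: (@eq_measurable_fun _ _ _ _ _ (fun t => (\int[mu]_(x in sym_itv n) f t x)%:E)).
    move=> t /set_mem; rewrite /= in_itv /= => tT.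
    rewrite /Rintegral fineK//; apply: integrable_fin_num; first exact: measurable_sym_itv.
    apply: continuous_compact_integrable; first exact: compact_sym_itv.
    apply: continuous_subspaceT; exact: C0_strip_slice cf tT.
  apply/measurable_EFinP; apply: subspace_continuous_measurable_fun => //.
  exact: C0_time_integral_sym_itv.
move=> t; rewrite /= in_itv /= => tT; apply: cvg_integral_sym_itv.
  apply: continuous_emeasurable; exact: C0_strip_slice cf tT.
by move=> x; rewrite lee_fin.
Qed.

(** The integral may be infinite at some times; it is measurable as a difference
    of limits of integrals over compact intervals, which are continuous in time. *)
Lemma measurable_integral f : C0_strip T f ->
  measurable_fun `[0, T] (fun t => (\int[mu]_x (f t x)%:E)%E).
Proof.
move=> cf.
have -> : (fun t => (\int[mu]_x (f t x)%:E)%E) =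
   (fun t => (\int[mu]_x (Num.max (f t x) 0)%:E) - (\int[mu]_x (Num.max (- f t x) 0)%:E))%E.
  apply/funext => t; rewrite integralE; congr (_ - _)%E; apply: eq_integral => x _.
    by rewrite funeposE -EFin_max.
  by rewrite funenegE -EFinN -EFin_max.
apply: emeasurable_funB; apply: ge0_measurable_integral.
- apply: (@C0_strip_comp1 _ _ T0 (fun y => Num.max y 0) f _ cf) => x.
  by apply: (@continuous_max _ _ id (cst 0)); [exact: cvg_id|exact: cvg_cst].
- by move=> t x; rewrite le_max lexx orbT.
- apply: (@C0_strip_comp1 _ _ T0 (fun y => Num.max (- y) 0) f _ cf) => x.
  by apply: (@continuous_max _ _ -%R (cst 0)); [exact: opp_continuous|exact: cvg_cst].
- by move=> t x; rewrite le_max lexx orbT.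
Qed.

(** In the extended reals, [+oo - +oo = -oo]: a finite value of an integral excludes
    that either part is infinite. *)
Lemma integral_fin_num_integrable (f : R -> \bar R) (D : set R) :
  measurable D -> measurable_fun D f -> (\int[mu]_(x in D) f x)%E \is a fin_num ->
  mu.-integrable D f.
Proof.
move=> mD mf; rewrite integralE => fin; apply/integrableP; split=> //.
have -> : (fun x => `|f x|)%E = (f^\+ \+ f^\-)%E by rewrite -fune_abse.
rewrite ge0_integralD//; last 2 first.
  exact: measurable_funepos.
  exact: measurable_funeneg.
have p0 : (0 <= \int[mu]_(x in D) f^\+ x)%E by apply: integral_ge0.
have n0 : (0 <= \int[mu]_(x in D) f^\- x)%E by apply: integral_ge0.
move: fin p0 n0; case: (integral _ _ _) => [r| |]; case: (integral _ _ _) => [r'| |] //= _ _ _.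
by rewrite -EFinD ltry.
Qed.

Lemma ge0_integral_eq0 (g : R -> R) : C0_time T g -> (forall t, 0 <= g t) ->
  (\int[mu]_(t in `[0%R, T]) (g t)%:E = 0)%E -> forall t, 0 <= t <= T -> g t = 0.
Proof.
move=> cg g0 int0 t tT; apply/eqP; rewrite eq_le g0 andbT leNgt; apply/negP => gt0.
have [d d0 gd] := C0_strip_dist T0 0 (C0_strip_time T0 cg) tT (divr_gt0 gt0 (ltr0n _ 2)).
have [t0 tT'] := andP tT.
(* If [0 < g t], then [g] exceeds [g t / 2] on the nondegenerate interval [[a, b]]. *)
pose a := Num.max 0 (t - d / 2); pose b := Num.min T (t + d / 2).
have ab : a < b.
  by rewrite /a /b gt_max !lt_min T0 /=; apply/andP; split; [|apply/andP; split]; lra.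
have a0 : 0 <= a by rewrite /a le_max lexx.
have bT : b <= T by rewrite /b ge_min lexx.
have ad : t - d / 2 <= a by rewrite /a le_max lexx orbT.
have bd : b <= t + d / 2 by rewrite /b ge_min lexx orbT.
have mg : measurable_fun `[0, T] (EFin \o g).
  by apply/measurable_EFinP; apply: subspace_continuous_measurable_fun.
have sub : `[a, b] `<=` `[0, T].
  move=> s; rewrite /= !in_itv /= => /andP[? ?]; apply/andP; split; lra.
have : ((g t / 2 * (b - a))%:E <= \int[mu]_(s in `[0%R, T]) (g s)%:E)%E.
  apply: (@le_trans _ _ (\int[mu]_(s in `[a, b]) (g s)%:E)%E); last first.
    by apply: ge0_subset_integral => // s _; rewrite lee_fin.
  have -> : (g t / 2 * (b - a))%:E = (\int[mu]_(s in `[a, b]) (g t / 2)%:E)%E.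
    by rewrite integral_cst//= lebesgue_measure_itv /= lte_fin ab -EFinB -EFinM.
  apply: ge0_le_integral => //.
  - by move=> s _; rewrite lee_fin divr_ge0.
  - exact: measurable_funS mg.
  - move=> s; rewrite /= in_itv /= lee_fin => /andP[as_ sb].
    have := gd s 0; rewrite subrr normr0 ler_distl => /(_ _ _ d0) h.
    have : g t - g t / 2 <= g s <= g t + g t / 2.
      by apply: h; [apply/andP; split; lra|rewrite ltr_norml; apply/andP; split; lra].
    by move=> /andP[]; lra.
rewrite int0 lee_fin leNgt => /negP; apply.
by rewrite mulr_gt0// ?divr_gt0// subr_gt0.
Qed.

(** If the functional [J] depends on [e] through [e * g t * b t x] only, where [g]
    is itself the space integral of [b], then [J e = J 0 - e * c] with [c] the
    integral of the square of [g]; stationarity forces [c = 0]. The finiteness of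
    [J 0] makes the space integral of [a] finite for almost every [t], which is
    enough to split the inner integral. *)
Lemma linear_variation_eq0 (a b : R -> R -> R) (g : R -> R) :
  C0_strip T a -> C0_strip T b ->
  (forall t, 0 <= t <= T -> mu.-integrable setT (EFin \o b t)) ->
  (forall t, g t = \int[mu]_x b t x) -> C0_time T g ->
  let J (e : R) := (\int[mu]_(t in `[0%R, T]) \int[mu]_x
     (a t x - e * g t * b t x)%:E)%E in
  (\forall e \near (0 : R), J e \is a fin_num) ->
  is_derive (0 : R) 1 (fun e => fine (J e)) 0 ->
  forall t, 0 <= t <= T -> g t = 0.
Proof.
move=> ca cb bi gE cg J Jfin Jder.
pose I t := (\int[mu]_x (a t x)%:E)%E.
have mI : measurable_fun `[0, T] I by exact: measurable_integral.
have J0 : J 0 = (\int[mu]_(t in `[0%R, T]) I t)%E.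
  apply: eq_integral => t _; apply: eq_integral => x _.
  by rewrite mul0r mul0r subr0.
have I_fin : (\int[mu]_(t in `[0%R, T]) I t)%E \is a fin_num.
  by rewrite -J0; exact: nbhs_singleton Jfin.
have Ii : mu.-integrable `[0, T] I.
  by apply: integral_fin_num_integrable.
have cg2 : C0_time T (fun t => g t ^+ 2).
  apply/(C0_timeP T0) => t.
  by apply: cvgM; exact: (C0_timeP T0 g).1.
have g2i : mu.-integrable `[0, T] (EFin \o (fun t => g t ^+ 2)).
  by apply: continuous_compact_integrable => //; exact: segment_compact.
pose c := \int[mu]_(t in `[0, T]) (g t ^+ 2).
have JE e : J e = ((\int[mu]_(t in `[0%R, T]) I t) - (e * c)%:E)%E.
  rewrite EFinM /c /Rintegral fineK; last exact: integrable_fin_num.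
  have eg2i := @integrableZl _ _ R mu _ (measurable_itv _) e _ g2i.
  rewrite -(@integralZl _ _ R mu _ (measurable_itv _) _ g2i).
  rewrite -(@integralB _ _ R mu _ (measurable_itv _) _ _ Ii eg2i).
  apply: (@ae_eq_integral _ _ R mu _ _ _ (measurable_itv _)).
  - apply: (@measurable_integral (fun t x => a t x - e * g t * b t x)).
    apply: (C0_stripD T0 ca); apply: (C0_stripN T0).
    apply: (C0_stripM T0 _ cb); apply: (C0_strip_time T0); apply/(C0_timeP T0) => t.
    by apply: cvgM; [exact: cvg_cst|exact: (C0_timeP T0 g).1].
  - apply: (emeasurable_funB mI); apply: measurable_funeM.
    exact: measurable_int g2i.
  have aeI := @integrable_ae _ _ R mu _ (measurable_itv _) _ Ii.
  apply: filterS aeI => t It tT; have {}It := It tT.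
  have tT' : 0 <= t <= T by move: tT; rewrite /= in_itv.
  have ai : mu.-integrable setT (EFin \o a t).
    apply: integral_fin_num_integrable => //.
    by apply: continuous_emeasurable; exact: C0_strip_slice ca tT'.
  have -> : (\int[mu]_x (a t x - e * g t * b t x)%:E =
     \int[mu]_x ((a t x)%:E - (e * g t)%:E * (b t x)%:E))%E by [].
  have ebi := @integrableZl _ _ R mu _ measurableT (e * g t) _ (bi t tT').
  rewrite (@integralB _ _ R mu _ measurableT _ _ ai ebi).
  rewrite (@integralZl _ _ R mu _ measurableT _ (bi t tT')).
  congr (_ - _)%E.
  rewrite -EFinM expr2 mulrA EFinM; congr (_ * _)%E.
  by rewrite gE /Rintegral fineK//; exact: (integrable_fin_num _ (bi t tT')).
set K := fine (\int[mu]_(t in `[0%R, T]) I t)%E.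
(* [J] is affine in [e], with slope [- c]. *)
have fJ : (fun e => fine (J e)) = cst K - c *: (id : R -> R).
  by apply/funext => e; rewrite JE fineB//= mulrC.
have dJ : is_derive (0 : R) 1 (cst K - c *: (id : R -> R)) (0 - c *: 1).
  by apply: is_deriveB; apply: is_deriveZ.
have c0 : c = 0.
  move: Jder; rewrite fJ => -[_ D0]; case: dJ => _.
  by rewrite D0 sub0r /GRing.scale /= mulr1 => /eqP; rewrite eq_sym oppr_eq0 => /eqP.
move=> t tT; apply/eqP; rewrite -sqrf_eq0; apply/eqP.
apply: (@ge0_integral_eq0 (fun t => g t ^+ 2)) => //; first by move=> s; exact: sqr_ge0.
by move: c0; rewrite /c /Rintegral => c0; rewrite -[LHS]fineK ?c0//; exact: integrable_fin_num.
Qed.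

End ParamIntegrals.

(** * The momentum of a critical point *)

Section Momentum.
Set Implicit Arguments.
Unset Strict Implicit.
Context {R : realType} (T kappa : R) (H w : R -> R) (phi : R -> R -> R).
Hypothesis T0 : 0 < T.
Hypothesis kappa0 : 0 < kappa.
Hypothesis Hd : forall x, derivable H x 1.
Hypothesis H'd : forall x, derivable (derive1 H) x 1.
Hypothesis H''d : forall x, derivable (derive1 (derive1 H)) x 1.
Hypothesis H''ge : forall x, kappa <= derive1 (derive1 H) x.
Hypothesis phiC2 : C2_strip T phi.
Hypothesis phi_x_gt0 : forall t x : R, 0 <= t <= T -> 0 < px phi t x.
Local Notation mu := (@lebesgue_measure R).
Local Notation F := (legendre H).
Implicit Types (t x : R).

(** Up to sign, the velocity of the mass: [phi] is constant along [x' = - phi_t / phi_x]. *)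
Definition velocity t x : R := pt T phi t x / px phi t x.
(** The co-state [F'(phi_t / phi_x)] of the Hamiltonian formulation. *)
Definition momentum t x : R := derive1 F (velocity t x).

Let dF := legendre_derivable kappa0 Hd H'd H''ge.
Let dF' := legendre'_derivable kappa0 Hd H'd H''ge.
Let F'' v : R := derive1 (derive1 F) v.

Let velocity_x t x : R :=
  (px (pt T phi) t x * px phi t x - pt T phi t x * px (px phi) t x)
  / px phi t x ^+ 2.

Lemma C0_pt : C0_strip T (pt T phi). Proof. by have [[]] := phiC2. Qed.
Lemma C0_px : C0_strip T (px phi). Proof. by have [[]] := phiC2. Qed.

Lemma phi_x_neq0 t x : 0 <= t <= T -> px phi t x != 0.
Proof. by move=> tT; rewrite gt_eqF// phi_x_gt0. Qed.

Lemma C0_velocity : C0_strip T velocity.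
Proof.
apply: (C0_stripM T0 C0_pt); apply: (C0_stripV T0 _ C0_px).
exact: phi_x_neq0.
Qed.

Lemma is_derive_velocity t x : 0 <= t <= T ->
  is_derive x 1 (velocity t) (velocity_x t x).
Proof.
move=> tT; have [_ [_ d1 _ _] [_ d2 _ _]] := phiC2.
apply: is_derive_quotient; last exact: phi_x_neq0.
  by apply: derivable_is_derive1; exact: (d1 t x tT).2.
by apply: derivable_is_derive1; exact: (d2 t x tT).2.
Qed.

Lemma C0_velocity_x : C0_strip T velocity_x.
Proof.
have [_ [_ _ _ c1] [_ _ _ c2]] := phiC2.
apply: (C0_stripM T0).
  apply: (C0_stripD T0); first exact: (C0_stripM T0 c1 C0_px).
  by apply: (C0_stripN T0); exact: (C0_stripM T0 C0_pt c2).
apply: (C0_stripV T0); last exact: (C0_stripM T0 C0_px C0_px).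
by move=> t x tT; rewrite expf_neq0// phi_x_neq0.
Qed.

Lemma velocity_time t x : 0 <= t <= T ->
  exists l, has_time_derive T (velocity^~ x) t l.
Proof.
move=> tT; have [_ [_ d1 _ _] [_ d2 _ _]] := phiC2.
have dV : derivable (fun y : R => y^-1) (px phi t x) 1.
  by apply: derivableV; [exact: phi_x_neq0|exact: derivable_id].
have dinv := @has_time_derive_comp _ T (fun y => y^-1) (fun s => px phi s x) t _ dV
  (time_derivableP (d2 t x tT).1).
eexists; exact: (has_time_deriveM (time_derivableP (d1 t x tT).1) dinv).
Qed.

Lemma C0_momentum : C0_strip T momentum.
Proof. exact: (C0_strip_comp1 T0 (derivable_continuousT dF') C0_velocity). Qed.

Lemma is_derive_momentum t x : 0 <= t <= T ->
  is_derive x 1 (momentum t) (F'' (velocity t x) * velocity_x t x).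
Proof.
move=> tT; apply: is_derive1_comp; last exact: is_derive_velocity.
by apply: derivable_is_derive1; exact: dF'.
Qed.

Lemma momentum_derivable t x : 0 <= t <= T -> derivable (momentum t) x 1.
Proof. by move=> /(is_derive_momentum x)[]. Qed.

Lemma C0_momentum_x : C0_strip T (px momentum).
Proof.
apply: (eq_C0_strip T0 (f1 := fun t x => F'' (velocity t x) * velocity_x t x)).
  by move=> t x tT; rewrite /px (is_derive1_val (is_derive_momentum x tT)).
apply: (C0_stripM T0 _ C0_velocity_x).
apply: (C0_strip_comp1 T0 _ C0_velocity).
exact: (legendre''_continuous kappa0 Hd H'd H''d H''ge).
Qed.

Lemma momentum_time t x : 0 <= t <= T ->
  exists l, has_time_derive T (momentum^~ x) t l.
Proof.
move=> tT; have [l vl] := velocity_time x tT.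
exists (F'' (velocity t x) * l).
exact: (@has_time_derive_comp _ T (derive1 F) (velocity^~ x) t l (@dF' _) vl).
Qed.

Lemma H'_momentum t x : derive1 H (momentum t x) = velocity t x.
Proof. exact: (H'_legendre'K kappa0 Hd H'd H''ge). Qed.

Lemma is_derive_H_momentum t x : 0 <= t <= T ->
  is_derive x 1 (fun y => H (momentum t y)) (velocity t x * px momentum t x).
Proof.
move=> tT; rewrite -H'_momentum; apply: is_derive1_comp.
  by apply: derivable_is_derive1; exact: Hd.
by apply: derivable_is_derive1; exact: momentum_derivable.
Qed.

Lemma lagrangian_z_momentum t x : 0 <= t <= T ->
  lagrangian_z F (pt T phi t x) (px phi t x) = momentum t x.
Proof. by move=> tT; rewrite (lagrangian_zE _ dF (phi_x_gt0 x tT)). Qed.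

Lemma lagrangian_y_momentum t x : 0 <= t <= T ->
  lagrangian_y F (pt T phi t x) (px phi t x) = - H (momentum t x).
Proof.
move=> tT; rewrite (lagrangian_yE _ dF (phi_x_gt0 x tT)).
by rewrite (H_legendre' kappa0 Hd H'd H''ge) opprB.
Qed.

Lemma derive1_lagrangian_y t x : 0 <= t <= T ->
  derive1 (fun y => lagrangian_y F (pt T phi t y) (px phi t y)) x
  = - derive1 (fun y => H (momentum t y)) x.
Proof.
move=> tT.
rewrite (_ : (fun y => _) = - (fun y => H (momentum t y))); last first.
  by apply/funext => y; rewrite lagrangian_y_momentum.
have dH := is_derive_H_momentum x tT.
by rewrite (is_derive1_val dH); apply: is_derive1_val; exact: is_deriveN.
Qed.

Section Transport.
Context (V uT : R -> R) (kV ku : R).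
Hypothesis wC1 : C1_time T w.
Hypothesis dV : forall x, derivable V x 1.
Hypothesis duT : forall x, derivable uT x 1.
Hypothesis lipV : kV.-lipschitz V.
Hypothesis lipuT : ku.-lipschitz uT.
Hypothesis PDE : forall t x, 0 <= t <= T ->
  - time_derive T (fun s => momentum s x - w s) t
  + derive1 (fun y => H (momentum t y)) x + derive1 V x = 0.
Hypothesis terminal : forall x, momentum T x - w T = derive1 uT x.

(** The equation reads [q_t - H'(q) q_x = w' + V'] for the momentum [q], with
    [q = u_T' + w] at time [T]: a transport equation with bounded source and
    bounded terminal values. *)
Lemma momentum_bounded :
  exists2 K, 0 <= K & forall t x, 0 <= t <= T -> `|momentum t x| <= K.
Proof.
have [dw cw'] := wC1.
have [W wW] := C0_time_bounded T0 cw'.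
have bound t x : 0 <= t <= T -> `|momentum t x| <= (ku + `|w T|) + (W + kV + 1) * T.
  apply: (transport_bound T0 (a := fun p => - derive1 H p) C0_momentum C0_momentum_x).
  - by move=> s y sT; exact: momentum_derivable.
  - by move=> p; apply: cvgN; exact: (derivable_continuousT H'd).
  - move=> s y sT; have [l ql] := momentum_time y sT; exists l => //.
    have wl := time_derivableP (dw s sT).
    have := PDE y sT; rewrite (has_time_derive_val T0 sT (has_time_deriveB ql wl)).
    rewrite (is_derive1_val (is_derive_H_momentum y sT)) H'_momentum => e.
    have -> : l + - velocity s y * px momentum s y = time_derive T w s + derive1 V y.
      by move: e; set a := velocity s y * _; rewrite mulNr -/a => e; lra.
    apply: le_trans (ler_normD _ _) _; apply: lerD; first exact: wW.
    exact: (lipschitz_derive1_le lipV (@dV y)).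
  - move=> y; have -> : momentum T y = derive1 uT y + w T by rewrite -terminal subrK.
    apply: le_trans (ler_normD _ _) _; rewrite lerD2r.
    exact: (lipschitz_derive1_le lipuT (@duT y)).
eexists; last exact: bound.
by apply: le_trans (normr_ge0 _) (bound 0 0 _); rewrite lexx ltW.
Qed.

(** The velocity is [H'] of the bounded momentum. *)
Lemma velocity_bounded : exists2 M, 0 <= M &
  forall t x, 0 <= t <= T -> `|pt T phi t x| <= M * px phi t x.
Proof.
have [K K0 qK] := momentum_bounded.
have [||c _ cm] := @EVT_max R (fun p => `|derive1 H p|) (- K) K.
- lra.
- by apply: continuous_subspaceT => p; apply: cvg_norm; exact: (derivable_continuousT H'd).
exists `|derive1 H c| => // t x tT.
have -> : pt T phi t x = velocity t x * px phi t x.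
  by rewrite /velocity divfK// phi_x_neq0.
rewrite normrM (gtr0_norm (phi_x_gt0 x tT)) ler_pM2r ?phi_x_gt0//.
rewrite -H'_momentum; apply: cm; rewrite in_itv /= -ler_norml; exact: qK.
Qed.

Section Balance.
Context (m Q : R -> R).
Hypothesis cm : continuous m.
Hypothesis pm : probability_density m.
Hypothesis phi0 : forall x, phi 0 x = \int[mu]_(y in `]-oo, x]) m y.
Hypothesis cQ : C0_time T Q.

(** The integrand of the balance condition. *)
Definition flux t x : R := pt T phi t x + Q t * px phi t x.

Lemma C0_flux : C0_strip T flux.
Proof.
apply: (C0_stripD T0 C0_pt); apply: (C0_stripM T0 _ C0_px).
exact: C0_strip_time.
Qed.

Lemma flux_dominated : exists2 D, 0 <= D &
  forall t x, 0 <= t <= T -> `|flux t x| <= D * px phi t x.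
Proof.
have [M M0 vM] := velocity_bounded.
have [W QW] := C0_time_bounded T0 cQ.
have W0 : 0 <= W by apply: le_trans (normr_ge0 _) (QW 0 _); rewrite lexx ltW.
exists (M + W); first exact: addr_ge0.
move=> t x tT; apply: le_trans (ler_normD _ _) _; rewrite mulrDl.
apply: lerD; first exact: vM.
by rewrite normrM (gtr0_norm (phi_x_gt0 x tT)) ler_pM2r ?phi_x_gt0// QW.
Qed.

(** [phi t] is squeezed between two translates of the distribution function of [m]. *)
Lemma phi_01 t x : 0 <= t <= T -> 0 <= phi t x <= 1.
Proof.
move=> tT; have [M M0 vM] := velocity_bounded; have [C1phi _ _] := phiC2.
have /andP[lo hi] := finite_speed T0 x C1phi tT vM.
rewrite (le_trans _ lo) ?(le_trans hi)// phi0.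
  by have /andP[] := cdf_itv01 (x + M * t) cm pm.
by have /andP[] := cdf_itv01 (x - M * t) cm pm.
Qed.

Lemma phi_derivable t x : 0 <= t <= T -> derivable (phi t) x 1.
Proof. by move=> tT; have [[_ d _ _] _ _] := phiC2; exact: (d t x tT).2. Qed.

Lemma phi_x_integrable t : 0 <= t <= T ->
  mu.-integrable setT (EFin \o px phi t) /\
  forall n, (0 < n)%N ->
    \int[mu]_(x in ~` sym_itv n) px phi t x <= 1 - (phi t n%:R - phi t (- n%:R)).
Proof.
move=> tT; apply: (@distribution_integrable _ (px phi t) (phi t)).
- exact: (C0_strip_slice T0 C0_px tT).
- by move=> x; exact: phi_derivable.
- by move=> x.
- by move=> x; apply: ltW; exact: phi_x_gt0.
- by move=> x; exact: phi_01.
Qed.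

Lemma flux_integrable t : 0 <= t <= T -> mu.-integrable setT (EFin \o flux t).
Proof.
move=> tT; have [D D0 fD] := flux_dominated.
apply: (@le_integrable _ _ R mu setT measurableT _ (fun x => (D%:E * (px phi t x)%:E)%E)).
- apply: continuous_emeasurable; exact: (C0_strip_slice T0 C0_flux tT).
- move=> x _; rewrite /= lee_fin (le_trans (fD t x tT))//; exact: ler_norm.
- by apply: integrableZl => //; exact: (phi_x_integrable tT).1.
Qed.

(** The mass at time [t] outside [[- n, n]] comes from the initial mass outside
    [[- n + M T, n - M T]], uniformly in [t]. *)
Lemma phi_tails e : 0 < e -> exists2 n, (0 < n)%N &
  forall t, 0 <= t <= T -> 1 - (phi t n%:R - phi t (- n%:R)) <= e.
Proof.
move=> e0; have [M M0 vM] := velocity_bounded; have [C1phi _ _] := phiC2.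
have [n0 tails] := density_tails cm pm (divr_gt0 e0 (ltr0n R 2)).
(* Large enough for [n - M * t] to exceed [n0] at all times. *)
pose n := (n0 + (Num.bound (M * T)).+1)%N.
have MT0 : 0 <= M * T by rewrite mulr_ge0// ltW.
have nMT : n0%:R + M * T < n%:R.
  by rewrite /n natrD ltrD2l (lt_le_trans (archi_boundP MT0))// ler_nat.
exists n; first by rewrite /n addnS.
move=> t tT; have Mt : M * t <= M * T by rewrite ler_wpM2l//; case/andP: tT.
have xlarge : n0%:R < n%:R - M * t by lra.
have [lo hi] := tails _ xlarge.
have /andP[h1 _] := finite_speed T0 n%:R C1phi tT vM.
have /andP[_ h2] := finite_speed T0 (- n%:R) C1phi tT vM.
rewrite phi0 in h1; rewrite phi0 in h2.
have e1 : - n%:R + M * t = - (n%:R - M * t) by rewrite opprB addrC.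
rewrite e1 in h2.
have := le_trans hi h1; have := le_trans h2 lo; lra.
Qed.

(** The flux is dominated by the density [phi_x], whose tails are uniformly small. *)
Lemma C0_total_flux : C0_time T (fun t => \int[mu]_x flux t x).
Proof.
apply: (C0_time_integral T0 C0_flux flux_integrable) => e e0.
have [D D0 fD] := flux_dominated.
have D1 : 0 < D + 1 by rewrite ltr_wpDl.
(* [D] may vanish, hence the division by [D + 1]. *)
have [n n0 tails] := phi_tails (divr_gt0 e0 D1).
exists n => t tT.
have mS := measurableC (@measurable_sym_itv R n).
have [px_int px_tail] := phi_x_integrable tT.
have px_intS : mu.-integrable (~` sym_itv n) (EFin \o px phi t) by exact: integrableS px_int.
have fl_intS : mu.-integrable (~` sym_itv n) (EFin \o flux t).
  by apply: integrableS (flux_integrable tT).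
apply: le_trans (@le_normr_Rintegral _ _ R mu _ _ mS fl_intS) _.
apply: (@le_trans _ _ (\int[mu]_(x in ~` sym_itv n) (D * px phi t x))).
  apply: le_Rintegral => //.
  - exact: integrable_norm.
  - exact: (integrableZl _ D px_intS).
  - by move=> x _; exact: fD.
rewrite RintegralZl//.
apply: (@le_trans _ _ ((D + 1) * (e / (D + 1)))); last by rewrite mulrC divfK// gt_eqF.
apply: ler_pM => //.
- by apply: Rintegral_ge0 => x _; rewrite ltW// phi_x_gt0.
- by rewrite lerDl.
- exact: le_trans (px_tail n n0) (tails t tT).
Qed.

(** The variation of [w] in the direction of the total flux itself, which is an
    admissible direction since it is continuous. *)
Lemma total_flux_eq0 : continuous (derive1 uT) ->
  (forall b2, C0_time T b2 -> stationary_along T F Q V uT phi w (fun _ _ => 0) b2) ->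
  forall t, 0 <= t <= T -> \int[mu]_x flux t x = 0.
Proof.
move=> cuT' stat.
have cw : C0_time T w.
  apply: time_derivable_continuous => t tT; eexists.
  exact: (time_derivableP (wC1.1 t tT)).
pose a t x : R := F (velocity t x) * px phi t x - w t * flux t x - V x * px phi t x
  - derive1 uT x * pt T phi t x.
have ca : C0_strip T a.
  apply: (C0_stripD T0); last first.
    apply: (C0_stripN T0); apply: (C0_stripM T0 _ C0_pt).
    exact: (C0_strip_space T0 cuT').
  apply: (C0_stripD T0); last first.
    apply: (C0_stripN T0); apply: (C0_stripM T0 _ C0_px).
    exact: (C0_strip_space T0 (derivable_continuousT dV)).
  apply: (C0_stripD T0); last first.
    apply: (C0_stripN T0); apply: (C0_stripM T0 _ C0_flux).
    exact: (C0_strip_time T0 cw).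
  apply: (C0_stripM T0 _ C0_px).
  exact: (C0_strip_comp1 T0 (derivable_continuousT dF) C0_velocity).
pose beta t := \int[mu]_x flux t x.
pose J (e : R) := (\int[mu]_(t in `[0%R, T]) \int[mu]_x
     (a t x - e * beta t * flux t x)%:E)%E.
have JE e : functional T F Q V uT (fun t x => phi t x + e * 0)
    (fun t => w t + e * beta t) = J e.
  rewrite /functional (_ : (fun t x => phi t x + e * 0) = phi); last first.
    by apply/funext => t; apply/funext => x; rewrite mulr0 addr0.
  apply: eq_integral => t /set_mem; rewrite /= in_itv /= => tT.
  apply: eq_integral => x _.
  rewrite /lagrangian (phi_x_gt0 x tT) -!EFinB; congr EFin.
  by rewrite /a /velocity /flux; ring.
have [fin der] := stat _ C0_total_flux.
have finJ : \forall e \near (0 : R), J e \is a fin_num.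
  by apply: filterS fin => e; rewrite -JE.
have derJ : is_derive (0 : R) 1 (fun e => fine (J e)) 0.
  rewrite (_ : (fun e => fine (J e)) = (fun e => fine (functional T F Q V uT
    (fun t x => phi t x + e * 0) (fun t => w t + e * beta t)))); first exact: der.
  by apply/funext => e; rewrite JE.
exact: (@linear_variation_eq0 R T T0 a flux beta ca C0_flux flux_integrable
  (fun t => erefl) C0_total_flux finJ derJ).
Qed.

End Balance.
End Transport.
End Momentum.

(** * The equivalence *)

Theorem proposition2p3 (R : realType) (T : R) (m0 H V uT Q : R -> R)
    (phi : R -> R -> R) (w : R -> R)
    (hT : 0 < T)
    (hm0 : probability_density m0)
    (hF : exists c p : R, [/\ 0 < c, 1 < p &
            forall v, c * `|v| `^ p <= legendre H v])
    (hHd : forall (k : nat) (x : R), (k < 3)%N -> derivable (H^`(k)) x 1)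
    (hH : exists kappa C : R, [/\ 0 < kappa, 0 < C &
            forall x, kappa <= H^`(2) x /\ `|H^`(3) x| <= C])
    (hQ : Cinfty_time T Q)
    (hV2 : C2_line V) (huT2 : C2_line uT) (hm02 : C2_line m0)
    (hVlip : exists k : R, k.-lipschitz V)
    (huTlip : exists k : R, k.-lipschitz uT)
    (hVbd : exists M : R, forall x, `|V^`(2) x| <= M)
    (huTbd : exists M : R, forall x, `|uT^`(2) x| <= M)
    (hm0bd : exists M : R, forall x, `|m0^`(2) x| <= M)
    (hVconv : convex_function setT V) (huTconv : convex_function setT uT)
    (hadm : admissible T m0 phi w)
    (hcrit : critical_point T (legendre H) Q V uT phi w)
    (hpos : forall t x : R, 0 <= t <= T -> 0 < px phi t x) :
  euler_lagrange T (legendre H) Q V uT phi w <->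
  price_system T H (legendre H) Q V uT phi w.
Proof.
have [kappa [C [kappa0 _ H''C]]] := hH.
have Hd x : derivable H x 1 by exact: (hHd 0%N x isT).
have H'd x : derivable (derive1 H) x 1 by exact: (hHd 1%N x isT).
have H''d x : derivable (derive1 (derive1 H)) x 1 by exact: (hHd 2%N x isT).
have H''ge x : kappa <= derive1 (derive1 H) x by exact: (H''C x).1.
have [phiC2 wC1 phi0] := hadm.
pose q := momentum T H phi.
have euler_eq t x : 0 <= t <= T ->
    - time_derive T (fun s => lagrangian_z (legendre H) (pt T phi s x) (px phi s x) - w s) t
    - derive1 (fun y => lagrangian_y (legendre H) (pt T phi t y) (px phi t y)) x
    + derive1 V x
    = - time_derive T (fun s => q s x - w s) t
    + derive1 (fun y => H (q t y)) x + derive1 V x.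
  move=> tT.
  have lz s : 0 <= s <= T -> lagrangian_z (legendre H) (pt T phi s x) (px phi s x) - w s
      = q s x - w s.
    by move=> sT; rewrite (lagrangian_z_momentum kappa0 Hd H'd H''ge hpos x sT).
  by rewrite (time_derive_eq_in tT lz)
    (derive1_lagrangian_y kappa0 Hd H'd H''ge phiC2 hpos x tT) opprK.
have T_itv : 0 <= T <= T by rewrite lexx ltW.
have boundary_eq x :
    lagrangian_z (legendre H) (pt T phi T x) (px phi T x) = q T x.
  exact: (lagrangian_z_momentum kappa0 Hd H'd H''ge hpos x T_itv).
split=> [[EL bc stat]|[PDE _ terminal]].
- have PDE t x : 0 <= t <= T -> - time_derive T (fun s => q s x - w s) t
      + derive1 (fun y => H (q t y)) x + derive1 V x = 0.
    by move=> tT; rewrite -euler_eq//; exact: EL.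
  have terminal x : q T x - w T = derive1 uT x.
    by apply/eqP; rewrite -subr_eq0 -boundary_eq bc.
  split=> // t tT.
  have [dV _ _] := hV2; have [duT duT' _] := huT2; have [dm _ _] := hm02.
  have [kV lipV] := hVlip; have [ku lipuT] := huTlip.
  have cQ : C0_time T Q.
    apply: time_derivable_continuous => s sT; eexists.
    exact: (time_derivableP (hQ 0%N s sT)).
  have zero := total_flux_eq0 hT kappa0 Hd H'd H''d H''ge phiC2 hpos wC1 dV duT lipV lipuT
    PDE terminal (derivable_continuousT dm) hm0 phi0 cQ (derivable_continuousT duT') stat tT.
  have int := flux_integrable hT kappa0 Hd H'd H''d H''ge phiC2 hpos wC1 dV duT lipV lipuT
    PDE terminal (derivable_continuousT dm) hm0 phi0 cQ tT.
  rewrite -[X in (- X)%E](fineK (integrable_fin_num measurableT int)).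
  by rewrite [fine _]zero oppe0.
- split.
  + by move=> t x tT; rewrite euler_eq//; exact: PDE.
  + by move=> x; rewrite boundary_eq; apply/eqP; rewrite subr_eq0; apply/eqP; exact: terminal.
  + by move=> b2 cb2; apply: hcrit => //; exact: C1c_strip0.
Qed.
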